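(* Let $f$ be a complex-valued function such that $f(z)$ is analytic for $|z|<1$, $|f(z)|<1$ for $|z|<1$, and $f(0)=0$. Suppose that $f$ extends continuously to an arc $C$ on the unit circle $|z|=1$, with $|f(z)|=1$ for all $z\in C$. Then the length $s$ of $C$ and the length $\sigma$ of $f(C)$ (counted with multiplicity) satisfy $$\sigma\geq \frac{2}{1+|f'(0)|}\,s.$$
   Context: ''$f$ extends continuously to $C$'' means that $f$ extends to a continuous function on $\{z:|z|<1\}\cup C$, again denoted $f$. The length $\sigma$ of $f(C)$ is taken with multiplicity if $f(C)$ is a multiple covering of the image; that is, $\sigma$ is the length of the parametrized curve $t\mapsto f(e^{it})$, where $e^{it}$ traverses $C$ once. *)

(* Defs.v *)
From Stdlib Require Import Reals.
From Coquelicot Require Import Coquelicot.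
Open Scope R_scope.

Definition unit_disc (z : C) : Prop := Cmod z < 1.

(* [is_derive] over [C_AbsRing] is the complex derivative. *)
Definition analytic_on_disc (f : C -> C) : Prop :=
  forall z : C, unit_disc z -> ex_derive (K := C_AbsRing) (V := C_NormedModule) f z.

Definition expi (t : R) : C := (cos t, sin t).

(* A nondegenerate interval, with or without its endpoints, of length at most
   2 PI, so that [expi] goes at most once around the circle along it. *)
Definition arc_interval (I : R -> Prop) : Prop :=
  (exists t u, I t /\ I u /\ t < u) /\
  (forall t u v, I t -> I v -> t <= u <= v -> I u) /\
  (forall t u, I t -> I u -> u - t <= 2 * PI).

Definition unit_arc (I : R -> Prop) (z : C) : Prop :=
  exists t, I t /\ z = expi t.

(* [L] is the length of the polygonal line inscribed in the curve [g] at
   [t 0 <= t 1 <= ... <= t (S n)]; the sum has the [S n] terms i = 0, ..., n. *)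
Definition inscribed_length (I : R -> Prop) (g : R -> C) (L : R) : Prop :=
  exists (n : nat) (t : nat -> R),
    (forall i, (i <= S n)%nat -> I (t i)) /\
    (forall i, (i <= n)%nat -> t i <= t (S i)) /\
    L = sum_n (fun i => Cmod (g (t (S i)) - g (t i))) n.

(* Length of the parametrized curve [g] on [I], hence counted with
   multiplicity; [p_infty] if the curve is not rectifiable. *)
Definition curve_length (I : R -> Prop) (g : R -> C) : Rbar :=
  Lub_Rbar (inscribed_length I g).

(* Main.v *)
Require Import Defs.
From Stdlib Require Import Reals Arith Lra Lia Psatz ClassicalEpsilon.
From Coquelicot Require Import Coquelicot.
Open Scope R_scope.

(** Write [a] for [|f'(0)|]. Applying the Schwarz-Pick inequality to [f z / z] gives
    [|f z| <= b(r)] on [|z| = r], where [b(r) = r (r + a) / (1 + a r)] has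
    [b(1) = 1] and [b'(1) = 2 / (1 + a)]. For a short arc from [e^(ic)] to [e^(id)],
    let [u = f (e^(ic))] and let [p = (1 - conj u f) / (1 + conj u f)], which is
    holomorphic with [Re p >= (1 - |f|^2) / 4] in the disc and [Re p = 0] on the arc.
    Integrating [p dz / z] along the boundary of [r0 <= |z| <= r1], [c <= arg z <= d],
    and letting [r1] tend to [1], bounds [(d - c) (1 - b(r0)^2) / 4] by the integral
    over [[r0, 1]] of the difference of [Im p] on the two radii. Dividing by [1 - r0] and
    letting [r0] tend to [1] yields [(d - c) / (1 + a) <= |p (e^(id))|], while the chord
    [|f (e^(id)) - u|] is [|p (e^(id))|] times a factor close to [2].

    Complex differentiability alone is assumed of [f], so the maximum principle is
    derived from Goursat's bisection argument. *)

(** * Complex differentiability *)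

(** No derivative of [f] on the arc and no reflection across it is used: the boundary enters only
    through limits from inside the disc. The Cayley transform separates the two kinds of
    information. Its real part carries the Schwarz-Pick growth on the inner arc and vanishes in the
    limit on the outer one; its imaginary part is needed only on the two radii, where [p] tends to
    [0] and to [p (e^(id))]. The constant comes out because [(1 - b(r0)^2) / (1 - r0)] tends to
    [2 b'(1) = 4 / (1 + a)], and the [4] cancels the one from [|u + f|^2 <= 4]. The factor between
    [|p|] and the chord is near [2] on short arcs only, so a partition with small steps is needed,
    with every constant below [2 / (1 + a)].

    Quotients such as [f z / z] are known to be merely continuous at the point that is divided out.
    The mean value inequality and the maximum principle therefore tolerate isolated points of mere
    continuity, which takes the place of a theorem on removable singularities. Goursat's theorem is
    applied in polar coordinates, where a rectangle is a sector or a whole annulus. *)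

Definition continuous_C (f : C -> C) (z : C) : Prop :=
  continuous (T := AbsRing_UniformSpace C_AbsRing)
    (U := AbsRing_UniformSpace C_AbsRing) f z.

Definition differentiable_C (f : C -> C) (z : C) : Prop :=
  ex_derive (K := C_AbsRing) (V := C_NormedModule) f z.

Lemma continuous_C_eps (f : C -> C) (z : C) :
  continuous_C f z <->
  forall e, 0 < e -> exists d, 0 < d /\
    forall y, Cmod (y - z) < d -> Cmod (f y - f z) < e.
Proof.
  split.
  - intros H e He.
    destruct (proj1 (filterlim_locally _ _) H (mkposreal e He)) as [d Hd].
    exists d; split; [apply cond_pos | exact Hd].
  - intros H; apply filterlim_locally; intros e.
    destruct (H e (cond_pos e)) as (d & Hd & Hy).
    exists (mkposreal d Hd); exact Hy.
Qed.

(** The continuity of [f] on the arc is stated with the neighbourhoods of [C_UniformSpace], whereas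
    [continuous_C] uses the discs of the absolute value. *)
Lemma locally_C_eps (P : C -> Prop) (z : C) :
  locally (T := C_UniformSpace) z P <->
  exists d, 0 < d /\ forall y, Cmod (y - z) < d -> P y.
Proof.
  split.
  - intros H; apply locally_C in H; destruct H as [d Hd].
    exists d; split; [apply cond_pos | exact Hd].
  - intros (d & Hd & Hy); apply locally_C.
    exists (mkposreal d Hd); exact Hy.
Qed.

Lemma continuous_C_const (a z : C) : continuous_C (fun _ => a) z.
Proof.
  apply (continuous_const (U := AbsRing_UniformSpace C_AbsRing)
    (V := AbsRing_UniformSpace C_AbsRing)).
Qed.

Lemma continuous_C_id (z : C) : continuous_C (fun y => y) z.
Proof. apply (continuous_id (U := AbsRing_UniformSpace C_AbsRing)). Qed.

Lemma continuous_C_plus (f g : C -> C) (z : C) :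
  continuous_C f z -> continuous_C g z -> continuous_C (fun y => f y + g y)%C z.
Proof.
  exact (continuous_plus (U := AbsRing_UniformSpace C_AbsRing) (K := C_AbsRing)
    (V := AbsRing_NormedModule C_AbsRing) f g z).
Qed.

Lemma continuous_C_mult (f g : C -> C) (z : C) :
  continuous_C f z -> continuous_C g z -> continuous_C (fun y => f y * g y)%C z.
Proof.
  exact (continuous_mult (U := AbsRing_UniformSpace C_AbsRing) (K := C_AbsRing) f g z).
Qed.

Lemma Cmod_triangle_rev (x y : C) : Cmod x - Cmod y <= Cmod (x - y).
Proof.
  generalize (Cmod_triangle (x - y) y).
  replace (x - y + y)%C with x by ring; lra.
Qed.

Lemma Cmod_minus_sym (x y : C) : Cmod (x - y) = Cmod (y - x).
Proof. rewrite <- Cmod_opp; f_equal; ring. Qed.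

Lemma Cmod_pos_neq (x : C) : 0 < Cmod x -> x <> 0%C.
Proof. intros H; now apply Cmod_gt_0. Qed.

Lemma continuous_C_inv (f : C -> C) (z : C) :
  continuous_C f z -> f z <> 0%C -> continuous_C (fun y => / f y)%C z.
Proof.
  intros H Hz; apply continuous_C_eps; intros e He.
  assert (Hp : 0 < Cmod (f z)) by now apply Cmod_gt_0.
  set (m := Cmod (f z)) in *.
  assert (He' : 0 < Rmin (m / 2) (e * m * m / 2)).
  { apply Rmin_pos; [lra|].
    assert (0 < e * m) by nra. assert (0 < e * m * m) by nra. lra. }
  destruct (proj1 (continuous_C_eps f z) H _ He') as (d & Hd & Hy).
  exists d; split; [exact Hd|]; intros y Hyd; specialize (Hy y Hyd).
  assert (H1 : Cmod (f y - f z) < m / 2) by (eapply Rlt_le_trans; [exact Hy | apply Rmin_l]).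
  assert (H2 : Cmod (f y - f z) < e * m * m / 2) by (eapply Rlt_le_trans; [exact Hy | apply Rmin_r]).
  assert (H3 : m / 2 < Cmod (f y)).
  { generalize (Cmod_triangle_rev (f z) (f y)); rewrite Cmod_minus_sym; fold m; lra. }
  assert (Hfy : f y <> 0%C) by (apply Cmod_pos_neq; lra).
  replace (/ f y - / f z)%C with ((f z - f y) / (f y * f z))%C by (field; auto).
  rewrite Cmod_div, Cmod_mult by now apply Cmult_neq_0.
  fold m; rewrite (Cmod_minus_sym (f z)).
  assert (0 < Cmod (f y) * m) by nra.
  apply Rmult_lt_reg_r with (Cmod (f y) * m); [assumption|].
  unfold Rdiv; rewrite Rmult_assoc, Rinv_l by lra.
  assert (0 < e * m) by nra. nra.
Qed.

Lemma differentiable_C_intro (f : C -> C) (z l : C) :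
  (forall e, 0 < e -> exists d, 0 < d /\
    forall y, Cmod (y - z) < d -> Cmod (f y - f z - (y - z) * l) <= e * Cmod (y - z)) ->
  differentiable_C f z.
Proof.
  intros H; exists l; split.
  - apply (is_linear_scal_l (K := C_AbsRing) (V := C_NormedModule)).
  - intros x Hx e.
    rewrite <- (is_filter_lim_locally_unique _ _ Hx).
    destruct (H e (cond_pos e)) as (d & Hd & Hy).
    exists (mkposreal d Hd); exact Hy.
Qed.

Lemma differentiable_C_eps (f : C -> C) (z : C) :
  differentiable_C f z -> forall e, 0 < e -> exists d, 0 < d /\
    forall y, Cmod (y - z) < d ->
      Cmod (f y - f z - (y - z) * C_derive f z) <= e * Cmod (y - z).
Proof.
  intros Hf e He; destruct (C_derive_correct f z z Hf) as [_ H].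
  destruct (H z (fun P HP => HP) (mkposreal e He)) as [d Hd].
  exists d; split; [apply cond_pos | exact Hd].
Qed.

(** Filling in the derivative at [z] makes the quotient continuous there when [f] is differentiable
    at [z]; differentiability is established only off [z]. *)
Definition slope (f : C -> C) (z y : C) : C :=
  if Ceq_dec y z then C_derive f z else ((f y - f z) / (y - z))%C.

Lemma Cminus_neq_0 (x y : C) : x <> y -> (x - y)%C <> 0%C.
Proof. intros n E; apply n; rewrite <- (Cplus_0_r y), <- E; ring. Qed.

Lemma slope_eq (f : C -> C) (z y : C) : (f y - f z = (y - z) * slope f z y)%C.
Proof.
  unfold slope; destruct (Ceq_dec y z) as [->|n]; [ring|].
  field; now apply Cminus_neq_0.
Qed.

Lemma slope_continuous (f : C -> C) (z : C) :
  differentiable_C f z -> continuous_C (slope f z) z.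
Proof.
  intros H; apply continuous_C_eps; intros e He.
  destruct (differentiable_C_eps f z H (e / 2)) as (d & Hd & Hy); [lra|].
  exists d; split; [exact Hd|]; intros y Hyd; unfold slope.
  destruct (Ceq_dec z z) as [_|n]; [|congruence].
  destruct (Ceq_dec y z) as [->|n].
  - replace (C_derive f z - C_derive f z)%C with (RtoC 0) by ring; rewrite Cmod_0; lra.
  - assert (Hn := Cminus_neq_0 y z n); assert (Hp := proj1 (Cmod_gt_0 _) Hn).
    replace ((f y - f z) / (y - z) - C_derive f z)%C
      with ((f y - f z - (y - z) * C_derive f z) / (y - z))%C by (field; auto).
    rewrite Cmod_div by assumption.
    apply Rmult_lt_reg_r with (Cmod (y - z)); [assumption|].
    unfold Rdiv; rewrite Rmult_assoc, Rinv_l by lra.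
    specialize (Hy y Hyd); nra.
Qed.

(* Caratheodory's form of differentiability, which reduces the rules of
   differentiation to those of continuity. *)
Lemma differentiable_C_slope (f : C -> C) (z : C) :
  differentiable_C f z <-> exists phi, continuous_C phi z /\
    exists d, 0 < d /\ forall y, Cmod (y - z) < d -> (f y - f z = (y - z) * phi y)%C.
Proof.
  split.
  - intros H; exists (slope f z); split; [now apply slope_continuous|].
    exists 1; split; [lra|]; intros y _; apply slope_eq.
  - intros (phi & Hc & d0 & Hd0 & Hphi); apply (differentiable_C_intro f z (phi z)).
    intros e He.
    destruct (proj1 (continuous_C_eps phi z) Hc e He) as (d & Hd & Hy).
    exists (Rmin d0 d); split; [now apply Rmin_pos|]; intros y Hyd.
    assert (H1 := Rmin_l d0 d); assert (H2 := Rmin_r d0 d).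
    rewrite Hphi by lra.
    replace ((y - z) * phi y - (y - z) * phi z)%C with ((phi y - phi z) * (y - z))%C by ring.
    rewrite Cmod_mult; apply Rmult_le_compat_r; [apply Cmod_ge_0|].
    apply Rlt_le, Hy; lra.
Qed.

Lemma differentiable_C_continuous (f : C -> C) (z : C) :
  differentiable_C f z -> continuous_C f z.
Proof.
  intros H; set (l := C_derive f z).
  destruct (differentiable_C_eps f z H 1) as (d & Hd & Hy); [lra|]; fold l in Hy.
  apply continuous_C_eps; intros e He.
  assert (Hl := Cmod_ge_0 l).
  assert (Hq : 0 < e / (2 + Cmod l)) by (apply Rdiv_lt_0_compat; lra).
  exists (Rmin d (e / (2 + Cmod l))); split; [now apply Rmin_pos|]; intros y Hyd.
  assert (H1 := Rmin_l d (e / (2 + Cmod l))); assert (H2 := Rmin_r d (e / (2 + Cmod l))).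
  specialize (Hy y ltac:(lra)).
  generalize (Cmod_triangle_rev (f y - f z) ((y - z) * l)).
  rewrite Cmod_mult.
  assert (H3 : Cmod (y - z) * (2 + Cmod l) < e).
  { replace e with (e / (2 + Cmod l) * (2 + Cmod l)) by (field; lra).
    apply Rmult_lt_compat_r; lra. }
  assert (Hn := Cmod_ge_0 (y - z)); nra.
Qed.

Lemma differentiable_C_const (a z : C) : differentiable_C (fun _ => a) z.
Proof. apply (ex_derive_const (K := C_AbsRing) (V := C_NormedModule)). Qed.

Lemma differentiable_C_id (z : C) : differentiable_C (fun y => y) z.
Proof.
  apply differentiable_C_slope; exists (fun _ => 1%C); split; [apply continuous_C_const|].
  exists 1; split; [lra|]; intros y _; ring.
Qed.

Lemma differentiable_C_plus (f g : C -> C) (z : C) :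
  differentiable_C f z -> differentiable_C g z ->
  differentiable_C (fun y => f y + g y)%C z.
Proof. apply (ex_derive_plus (K := C_AbsRing) (V := C_NormedModule)). Qed.

Lemma differentiable_C_mult (f g : C -> C) (z : C) :
  differentiable_C f z -> differentiable_C g z ->
  differentiable_C (fun y => f y * g y)%C z.
Proof.
  intros Hf Hg.
  assert (Hc := differentiable_C_continuous g z Hg).
  apply differentiable_C_slope in Hf; destruct Hf as (phi & Hphi & d & Hd & Hy).
  apply differentiable_C_slope in Hg; destruct Hg as (psi & Hpsi & d' & Hd' & Hy').
  apply differentiable_C_slope.
  exists (fun y => phi y * g y + f z * psi y)%C; split.
  - apply continuous_C_plus; apply continuous_C_mult; auto using continuous_C_const.
  - exists (Rmin d d'); split; [now apply Rmin_pos|]; intros y Hyd.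
    assert (H1 := Rmin_l d d'); assert (H2 := Rmin_r d d').
    replace (f y * g y - f z * g z)%C
      with ((f y - f z) * g y + f z * (g y - g z))%C by ring.
    rewrite Hy, Hy' by lra; ring.
Qed.

Lemma differentiable_C_inv (f : C -> C) (z : C) :
  differentiable_C f z -> f z <> 0%C -> differentiable_C (fun y => / f y)%C z.
Proof.
  intros H Hz.
  assert (Hc := differentiable_C_continuous f z H).
  apply differentiable_C_slope in H; destruct H as (phi & Hphi & d & Hd & Hy).
  assert (Hp := proj1 (Cmod_gt_0 _) Hz).
  destruct (proj1 (continuous_C_eps f z) Hc _ Hp) as (d' & Hd' & Hy').
  apply differentiable_C_slope.
  exists (fun y => phi y * (- / f z * / f y))%C; split.
  - apply continuous_C_mult; [assumption|].
    apply continuous_C_mult; [apply continuous_C_const | now apply continuous_C_inv].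
  - exists (Rmin d d'); split; [now apply Rmin_pos|]; intros y Hyd.
    assert (H1 := Rmin_l d d'); assert (H2 := Rmin_r d d').
    assert (Hfy : f y <> 0%C).
    { apply Cmod_pos_neq.
      generalize (Hy' y ltac:(lra)) (Cmod_triangle_rev (f z) (f y)).
      rewrite Cmod_minus_sym; lra. }
    replace (/ f y - / f z)%C with ((f y - f z) * (- / f z * / f y))%C by (field; auto).
    rewrite Hy by lra; ring.
Qed.

Lemma differentiable_C_ext_loc (f g : C -> C) (z : C) (d : R) :
  0 < d -> (forall y, Cmod (y - z) < d -> f y = g y) ->
  differentiable_C f z -> differentiable_C g z.
Proof.
  intros Hd H; apply (ex_derive_ext_loc (K := C_AbsRing) (V := C_NormedModule)).
  exists (mkposreal d Hd); exact H.
Qed.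

Lemma continuous_C_ext_loc (f g : C -> C) (z : C) (d : R) :
  0 < d -> (forall y, Cmod (y - z) < d -> f y = g y) ->
  continuous_C f z -> continuous_C g z.
Proof.
  intros Hd H Hf; apply continuous_C_eps; intros e He.
  destruct (proj1 (continuous_C_eps f z) Hf e He) as (d' & Hd' & Hy).
  exists (Rmin d d'); split; [now apply Rmin_pos|]; intros y Hyd.
  assert (H1 := Rmin_l d d'); assert (H2 := Rmin_r d d').
  rewrite <- !H; [apply Hy; lra | | lra].
  replace (z - z)%C with (RtoC 0) by ring; rewrite Cmod_0; lra.
Qed.

(** Near a point other than [z] the case distinction is constant. The quotient is spelled with sums,
    products and inverses so that the rules of calculus apply to it. *)
Lemma slope_off (f : C -> C) (z y : C) :
  y <> z -> 0 < Cmod (y - z) /\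
  forall x, Cmod (x - y) < Cmod (y - z) -> ((f x + - f z) * / (x + - z) = slope f z x)%C.
Proof.
  intros n; split; [now apply Cmod_gt_0, Cminus_neq_0|].
  intros x Hx; unfold slope; destruct (Ceq_dec x z) as [->|]; [|reflexivity].
  rewrite Cmod_minus_sym in Hx; lra.
Qed.

Lemma slope_continuous_off (f : C -> C) (z y : C) :
  y <> z -> continuous_C f y -> continuous_C (slope f z) y.
Proof.
  intros n Hf; destruct (slope_off f z y n) as [Hd H].
  apply (continuous_C_ext_loc _ _ _ _ Hd H).
  apply continuous_C_mult; [|apply continuous_C_inv; [|now apply Cminus_neq_0]].
  - apply continuous_C_plus; [exact Hf | apply continuous_C_const].
  - apply continuous_C_plus; [apply continuous_C_id | apply continuous_C_const].
Qed.

Lemma slope_differentiable_off (f : C -> C) (z y : C) :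
  y <> z -> differentiable_C f y -> differentiable_C (slope f z) y.
Proof.
  intros n Hf; destruct (slope_off f z y n) as [Hd H].
  apply (differentiable_C_ext_loc _ _ _ _ Hd H).
  apply differentiable_C_mult; [|apply differentiable_C_inv; [|now apply Cminus_neq_0]].
  - apply differentiable_C_plus; [exact Hf | apply differentiable_C_const].
  - apply differentiable_C_plus; [apply differentiable_C_id | apply differentiable_C_const].
Qed.

(** * Goursat's theorem on a rectangle *)

(** Nested intervals: the common point is the limit of the left endpoints. *)
Lemma monotone_halving (u : nat -> R) (h : R) :
  0 < h ->
  (forall n, u n <= u (S n)) ->
  (forall n, u (S n) + h / 2 ^ S n <= u n + h / 2 ^ n) ->
  exists p, forall n, u n <= p <= u n + h / 2 ^ n.
Proof.
  intros Hh Hu Hv.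
  assert (Hp : forall n, 0 < h / 2 ^ n).
  { intros n; apply Rdiv_lt_0_compat; [assumption | apply pow_lt; lra]. }
  assert (Hv' : forall n, u n + h / 2 ^ n <= u 0%nat + h).
  { induction n as [|n IH]; [simpl; lra|]. specialize (Hv n); lra. }
  destruct (ex_finite_lim_seq_incr u (u 0%nat + h) Hu) as [p Hlim].
  { intros n; specialize (Hp n); specialize (Hv' n); lra. }
  exists p; intros n; split.
  - exact (is_lim_seq_incr_compare u p Hlim Hu n).
  - assert (Hmk : forall m k, u (m + k)%nat + h / 2 ^ (m + k) <= u m + h / 2 ^ m).
    { intros m k; induction k as [|k IH]; [rewrite Nat.add_0_r; lra|].
      rewrite Nat.add_succ_r; specialize (Hv (m + k)%nat); lra. }
    refine (is_lim_seq_le (fun k => u (k + n)%nat) (fun _ => u n + h / 2 ^ n)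
      p (u n + h / 2 ^ n) _ _ _).
    + intros k; rewrite Nat.add_comm.
      specialize (Hmk n k); specialize (Hp (n + k)%nat); lra.
    + now apply is_lim_seq_incr_n.
    + apply is_lim_seq_const.
Qed.

(** The predicate is arbitrary because the bisection serves twice, for Goursat's theorem and for the
    existence of a maximum on a closed disc. The common factor [l], a power of one half, records
    that the rectangles keep their shape. *)
Lemma rectangle_bisection (Q : R -> R -> R -> R -> Prop) (x y h k : R) :
  0 < h -> 0 < k -> Q x y h k ->
  (forall x y h k, 0 < h -> 0 < k -> Q x y h k ->
    Q x y (h / 2) (k / 2) \/ Q (x + h / 2) y (h / 2) (k / 2) \/
    Q x (y + k / 2) (h / 2) (k / 2) \/ Q (x + h / 2) (y + k / 2) (h / 2) (k / 2)) ->
  exists p q, forall e, 0 < e -> exists l u v, 0 < l < e /\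
    Q u v (l * h) (l * k) /\ u <= p <= u + l * h /\ v <= q <= v + l * k.
Proof.
  intros Hh Hk HQ Hquarter.
  assert (Hpos : forall n a, 0 < a -> 0 < a / 2 ^ n).
  { intros n a Ha; apply Rdiv_lt_0_compat; [assumption | apply pow_lt; lra]. }
  (* With [Q] as a premise under the existential, the next corner can be chosen for every pair,
     before [Q] is known along the sequence. *)
  assert (Hstep : forall n (c : R * R), exists c' : R * R,
    Q (fst c) (snd c) (h / 2 ^ n) (k / 2 ^ n) ->
    Q (fst c') (snd c') (h / 2 ^ S n) (k / 2 ^ S n) /\
    fst c <= fst c' /\ fst c' + h / 2 ^ S n <= fst c + h / 2 ^ n /\
    snd c <= snd c' /\ snd c' + k / 2 ^ S n <= snd c + k / 2 ^ n).
  { intros n [a b]; simpl fst; simpl snd.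
    destruct (excluded_middle_informative (Q a b (h / 2 ^ n) (k / 2 ^ n))) as [HQn|HQn];
      [|exists (a, b); tauto].
    assert (E : forall r, r / 2 ^ S n = r / 2 ^ n / 2)
      by (intros r; simpl; field; apply pow_nonzero; lra).
    rewrite !E.
    assert (Hhn := Hpos n h Hh); assert (Hkn := Hpos n k Hk).
    destruct (Hquarter a b _ _ Hhn Hkn HQn) as [H|[H|[H|H]]];
      [exists (a, b) | exists (a + h / 2 ^ n / 2, b) | exists (a, b + k / 2 ^ n / 2)
      | exists (a + h / 2 ^ n / 2, b + k / 2 ^ n / 2)];
      simpl; intros _; repeat split; try assumption; lra. }
  pose (next n c := proj1_sig (constructive_indefinite_description _ (Hstep n c))).
  pose (corner := fix corner n := match n with O => (x, y) | S m => next m (corner m) end).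
  assert (HQn : forall n, Q (fst (corner n)) (snd (corner n)) (h / 2 ^ n) (k / 2 ^ n)).
  { induction n as [|n IH].
    - simpl; now rewrite !Rdiv_1_r.
    - simpl corner; unfold next.
      destruct (constructive_indefinite_description _ (Hstep n (corner n))) as [c' Hc'].
      exact (proj1 (Hc' IH)). }
  assert (Hc : forall n, fst (corner n) <= fst (corner (S n)) /\
    fst (corner (S n)) + h / 2 ^ S n <= fst (corner n) + h / 2 ^ n /\
    snd (corner n) <= snd (corner (S n)) /\
    snd (corner (S n)) + k / 2 ^ S n <= snd (corner n) + k / 2 ^ n).
  { intros n; simpl corner; unfold next.
    destruct (constructive_indefinite_description _ (Hstep n (corner n))) as [c' Hc'].
    exact (proj2 (Hc' (HQn n))). }
  destruct (monotone_halving (fun n => fst (corner n)) h Hh) as [p Hp];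
    [intros n; apply Hc | intros n; apply Hc |].
  destruct (monotone_halving (fun n => snd (corner n)) k Hk) as [q Hq];
    [intros n; apply Hc | intros n; apply Hc |].
  exists p, q; intros e He.
  destruct (pow_lt_1_zero (/ 2) ltac:(rewrite Rabs_pos_eq; lra) e He) as [n Hn].
  exists ((/ 2) ^ n), (fst (corner n)), (snd (corner n)).
  assert (Hl : 0 < (/ 2) ^ n) by (apply pow_lt; lra).
  specialize (Hn n (le_n n)); rewrite Rabs_pos_eq in Hn by lra.
  assert (E : forall r, (/ 2) ^ n * r = r / 2 ^ n)
    by (intros r; rewrite pow_inv; unfold Rdiv; ring).
  rewrite !E; repeat split; auto; [apply Hp | apply Hp | apply Hq | apply Hq].
Qed.

Lemma RInt_near_const (g : R -> R) (x h c m : R) :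
  0 <= h -> ex_RInt g x (x + h) ->
  (forall s, x <= s <= x + h -> Rabs (g s - c) <= m) ->
  Rabs (RInt g x (x + h) - h * c) <= h * m.
Proof.
  intros Hh Hg H.
  assert (E : RInt g x (x + h) - h * c = RInt (fun s => g s - c) x (x + h)).
  { rewrite (RInt_minus (V := R_CompleteNormedModule) g (fun _ => c));
      [|assumption | apply ex_RInt_const].
    rewrite RInt_const; unfold minus, plus, opp, scal; simpl; unfold mult; simpl; ring. }
  rewrite E; replace (h * m) with ((x + h - x) * m) by ring.
  apply abs_RInt_le_const; [lra | | assumption].
  apply (ex_RInt_minus (V := R_CompleteNormedModule) g (fun _ => c));
    [assumption | apply ex_RInt_const].
Qed.

(* Integral of [A ds + B dt] along the boundary of [x, x + h] * [y, y + k]. *)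
Definition circulation (A B : R -> R -> R) (x y h k : R) : R :=
  RInt (fun s => A s y - A s (y + k)) x (x + h)
  + RInt (fun t => B (x + h) t - B x t) y (y + k).

Lemma differentiable_pt_lim_continuity_2d (f : R -> R -> R) (x y lx ly : R) :
  differentiable_pt_lim f x y lx ly -> continuity_2d_pt f x y.
Proof.
  intros H; apply differentiable_continuity_pt; now exists lx, ly.
Qed.

Lemma continuity_2d_pt_1 (f : R -> R -> R) (x y : R) :
  continuity_2d_pt f x y -> continuous (fun s => f s y) x.
Proof.
  intros H; apply continuity_pt_filterlim, continuity_pt_locally; intros e.
  exact (locally_2d_1d_const_y _ _ _ (H e)).
Qed.

Lemma continuity_2d_pt_2 (f : R -> R -> R) (x y : R) :
  continuity_2d_pt f x y -> continuous (fun t => f x t) y.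
Proof.
  intros H; apply continuity_pt_filterlim, continuity_pt_locally; intros e.
  exact (locally_2d_1d_const_x _ _ _ (H e)).
Qed.

Lemma RInt_slice_Chasles (g : R -> R) (a b h : R) :
  0 <= h -> (forall s, a <= s <= a + h -> continuous g s) -> a <= b <= a + h ->
  RInt g a (a + h) = RInt g a b + RInt g b (a + h).
Proof.
  intros Hh Hg Hb; symmetry.
  apply (RInt_Chasles (V := R_CompleteNormedModule) g); apply ex_RInt_continuous; intros s;
    rewrite Rmin_left, Rmax_right by lra; intros Hs; apply Hg; lra.
Qed.

Section Goursat.

Variables (A B : R -> R -> R) (x0 y0 h0 k0 : R).
Hypothesis A_cont : forall s t,
  x0 <= s <= x0 + h0 -> y0 <= t <= y0 + k0 -> continuity_2d_pt A s t.
Hypothesis B_cont : forall s t,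
  x0 <= s <= x0 + h0 -> y0 <= t <= y0 + k0 -> continuity_2d_pt B s t.

Let inside (x y h k : R) : Prop :=
  x0 <= x /\ x + h <= x0 + h0 /\ y0 <= y /\ y + k <= y0 + k0.

Lemma ex_RInt_horizontal (x h y : R) :
  0 <= h -> x0 <= x -> x + h <= x0 + h0 -> y0 <= y <= y0 + k0 ->
  ex_RInt (fun s => A s y) x (x + h).
Proof.
  intros; apply (ex_RInt_continuous (V := R_CompleteNormedModule)); intros s.
  rewrite Rmin_left, Rmax_right by lra; intros Hs.
  apply continuity_2d_pt_1, A_cont; lra.
Qed.

Lemma ex_RInt_vertical (y k x : R) :
  0 <= k -> y0 <= y -> y + k <= y0 + k0 -> x0 <= x <= x0 + h0 ->
  ex_RInt (fun t => B x t) y (y + k).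
Proof.
  intros; apply (ex_RInt_continuous (V := R_CompleteNormedModule)); intros t.
  rewrite Rmin_left, Rmax_right by lra; intros Ht.
  apply continuity_2d_pt_2, B_cont; lra.
Qed.

Lemma circulation_sides (x y h k : R) :
  0 <= h -> 0 <= k -> inside x y h k ->
  circulation A B x y h k =
    RInt (fun s => A s y) x (x + h) - RInt (fun s => A s (y + k)) x (x + h)
    + (RInt (fun t => B (x + h) t) y (y + k) - RInt (fun t => B x t) y (y + k)).
Proof.
  unfold inside; intros Hh Hk Hin; unfold circulation.
  rewrite (RInt_minus (V := R_CompleteNormedModule) (fun s => A s y) (fun s => A s (y + k)))
    by (apply ex_RInt_horizontal; lra).
  rewrite (RInt_minus (V := R_CompleteNormedModule) (fun t => B (x + h) t) (fun t => B x t))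
    by (apply ex_RInt_vertical; lra).
  reflexivity.
Qed.

(** Each inner side is traversed twice in opposite directions and cancels. *)
Lemma circulation_quarters (x y h k : R) :
  0 <= h -> 0 <= k -> inside x y h k ->
  circulation A B x y h k =
    circulation A B x y (h / 2) (k / 2) + circulation A B (x + h / 2) y (h / 2) (k / 2)
    + circulation A B x (y + k / 2) (h / 2) (k / 2)
    + circulation A B (x + h / 2) (y + k / 2) (h / 2) (k / 2).
Proof.
  intros Hh Hk Hin.
  rewrite !circulation_sides by (unfold inside in *; lra).
  unfold inside in Hin.
  replace (x + h / 2 + h / 2) with (x + h) by lra.
  replace (y + k / 2 + k / 2) with (y + k) by lra.
  assert (HA : forall t, y0 <= t <= y0 + k0 -> RInt (fun s => A s t) x (x + h) =
    RInt (fun s => A s t) x (x + h / 2) + RInt (fun s => A s t) (x + h / 2) (x + h)).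
  { intros t Ht; apply RInt_slice_Chasles; [lra| |lra].
    intros s Hs; apply continuity_2d_pt_1, A_cont; lra. }
  assert (HB : forall s, x0 <= s <= x0 + h0 -> RInt (fun t => B s t) y (y + k) =
    RInt (fun t => B s t) y (y + k / 2) + RInt (fun t => B s t) (y + k / 2) (y + k)).
  { intros s Hs; apply RInt_slice_Chasles; [lra| |lra].
    intros t Ht; apply continuity_2d_pt_2, B_cont; lra. }
  rewrite !HA, !HB by lra; ring.
Qed.

(** The coefficient [b] shared by [A] and [B] says that the form is closed at [(p, q)]. The affine
    parts then contribute [- b * k * h] and [b * h * k], which cancel, and only the remainders, at
    most [e * (h + k)] on each side, are left. *)
Lemma circulation_local (p q a b c e : R) :
  differentiable_pt_lim A p q a b -> differentiable_pt_lim B p q b c -> 0 < e ->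
  exists d, 0 < d /\ forall x y h k, 0 <= h < d -> 0 <= k < d -> inside x y h k ->
    x <= p <= x + h -> y <= q <= y + k ->
    Rabs (circulation A B x y h k) <= 2 * e * (h + k) * (h + k).
Proof.
  intros HA HB He.
  destruct (HA (mkposreal e He)) as [d1 H1]; destruct (HB (mkposreal e He)) as [d2 H2].
  simpl in H1, H2.
  exists (Rmin d1 d2); split; [apply Rmin_pos; apply cond_pos|].
  intros x y h k Hh Hk Hin Hp Hq.
  assert (M1 := Rmin_l d1 d2); assert (M2 := Rmin_r d1 d2).
  assert (HM : forall s t, x <= s <= x + h -> y <= t <= y + k ->
    Rabs (s - p) < Rmin d1 d2 /\ Rabs (t - q) < Rmin d1 d2 /\
    Rmax (Rabs (s - p)) (Rabs (t - q)) <= h + k).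
  { intros s t Hs Ht.
    assert (Rabs (s - p) <= h) by (apply Rabs_le; lra).
    assert (Rabs (t - q) <= k) by (apply Rabs_le; lra).
    repeat split; try lra; apply Rmax_lub; lra. }
  assert (HA' : forall s t, x <= s <= x + h -> y <= t <= y + k ->
    Rabs (A s t - A p q - (a * (s - p) + b * (t - q))) <= e * (h + k)).
  { intros s t Hs Ht; destruct (HM s t Hs Ht) as (? & ? & ?).
    eapply Rle_trans; [apply H1; lra | apply Rmult_le_compat_l; lra]. }
  assert (HB' : forall s t, x <= s <= x + h -> y <= t <= y + k ->
    Rabs (B s t - B p q - (b * (s - p) + c * (t - q))) <= e * (h + k)).
  { intros s t Hs Ht; destruct (HM s t Hs Ht) as (? & ? & ?).
    eapply Rle_trans; [apply H2; lra | apply Rmult_le_compat_l; lra]. }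
  unfold inside in Hin; unfold circulation.
  assert (E1 := RInt_near_const (fun s => A s y - A s (y + k)) x h (- (b * k))
    (2 * (e * (h + k)))).
  assert (E2 := RInt_near_const (fun t => B (x + h) t - B x t) y k (b * h)
    (2 * (e * (h + k)))).
  lapply E1; [clear E1; intros E1 | lra].
  lapply E2; [clear E2; intros E2 | lra].
  lapply E1; [clear E1; intros E1
    | apply (ex_RInt_minus (V := R_CompleteNormedModule) (fun s => A s y)
        (fun s => A s (y + k))); apply ex_RInt_horizontal; lra].
  lapply E2; [clear E2; intros E2
    | apply (ex_RInt_minus (V := R_CompleteNormedModule) (fun t => B (x + h) t)
        (fun t => B x t)); apply ex_RInt_vertical; lra].
  lapply E1; [clear E1; intros E1|].
  2: { intros s Hs.
       generalize (HA' s y Hs ltac:(lra)) (HA' s (y + k) Hs ltac:(lra)); intros F1 F2.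
       apply Rabs_le_between in F1; apply Rabs_le_between in F2; apply Rabs_le; lra. }
  lapply E2; [clear E2; intros E2|].
  2: { intros t Ht.
       generalize (HB' (x + h) t ltac:(lra) Ht) (HB' x t ltac:(lra) Ht); intros F1 F2.
       apply Rabs_le_between in F1; apply Rabs_le_between in F2; apply Rabs_le; lra. }
  apply Rabs_le_between in E1; apply Rabs_le_between in E2; apply Rabs_le.
  revert E1 E2; generalize (RInt (fun s => A s y - A s (y + k)) x (x + h))
    (RInt (fun t => B (x + h) t - B x t) y (y + k)); intros; nra.
Qed.

Lemma circulation_eq_0 :
  (forall s t, x0 <= s <= x0 + h0 -> y0 <= t <= y0 + k0 -> exists a b c,
    differentiable_pt_lim A s t a b /\ differentiable_pt_lim B s t b c) ->
  0 < h0 -> 0 < k0 -> circulation A B x0 y0 h0 k0 = 0.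
Proof.
  intros Hdiff Hh0 Hk0; apply NNPP; intros Hne.
  assert (HS : 0 < Rabs (circulation A B x0 y0 h0 k0)) by now apply Rabs_pos_lt.
  assert (Ha0 : 0 < h0 * k0) by now apply Rmult_lt_0_compat.
  (* Half the ratio of circulation to area, so that the strict inequality passed down by the
     bisection holds at the start. Both quantities are additive, so some quarter inherits it. *)
  set (e := Rabs (circulation A B x0 y0 h0 k0) / 2 / (h0 * k0)).
  assert (He : 0 < e) by (unfold e; apply Rdiv_lt_0_compat; lra).
  destruct (rectangle_bisection
    (fun x y h k => inside x y h k /\ e * (h * k) < Rabs (circulation A B x y h k))
    x0 y0 h0 k0 Hh0 Hk0) as (p & q & Hpq).
  - split; [unfold inside; lra|].
    unfold e, Rdiv; rewrite Rmult_assoc, Rinv_l by lra; lra.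
  - intros x y h k Hh Hk [Hin Hbad]; unfold inside in *.
    rewrite circulation_quarters in Hbad by (unfold inside; lra).
    apply NNPP; intros Hno.
    assert (Hq : forall x' y', x <= x' <= x + h / 2 -> y <= y' <= y + k / 2 ->
      ~ ((x0 <= x' /\ x' + h / 2 <= x0 + h0 /\ y0 <= y' /\ y' + k / 2 <= y0 + k0) /\
        e * (h / 2 * (k / 2)) < Rabs (circulation A B x' y' (h / 2) (k / 2))) ->
      - (e * (h * k) / 4) <= circulation A B x' y' (h / 2) (k / 2) <= e * (h * k) / 4).
    { intros x' y' Hx' Hy' Hn; apply Rabs_le_between.
      destruct (Rle_lt_dec (Rabs (circulation A B x' y' (h / 2) (k / 2)))
        (e * (h * k) / 4)) as [|Hl]; [assumption|].
      exfalso; apply Hn; split; [lra|].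
      replace (e * (h / 2 * (k / 2))) with (e * (h * k) / 4) by field; exact Hl. }
    assert (Q1 := Hq x y ltac:(lra) ltac:(lra) ltac:(tauto)).
    assert (Q2 := Hq (x + h / 2) y ltac:(lra) ltac:(lra) ltac:(tauto)).
    assert (Q3 := Hq x (y + k / 2) ltac:(lra) ltac:(lra) ltac:(tauto)).
    assert (Q4 := Hq (x + h / 2) (y + k / 2) ltac:(lra) ltac:(lra) ltac:(tauto)).
    apply Rlt_not_le in Hbad; apply Hbad, Rabs_le; lra.
  - destruct (Hpq 1 Rlt_0_1) as (l1 & u1 & v1 & _ & [Hin1 _] & Hp1 & Hq1).
    unfold inside in Hin1.
    destruct (Hdiff p q ltac:(lra) ltac:(lra)) as (a & b & c & HA & HB).
    assert (Hs : 0 < (h0 + k0) * (h0 + k0)) by nra.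
    (* Chosen so that the bound of [circulation_local] on a rectangle of the same shape is half of
       [e] times its area. *)
    set (e' := e * (h0 * k0) / (4 * ((h0 + k0) * (h0 + k0)))).
    assert (He' : 0 < e') by (unfold e'; apply Rdiv_lt_0_compat; nra).
    destruct (circulation_local p q a b c e' HA HB He') as (d & Hd & Hloc).
    destruct (Hpq (d / (h0 + k0))) as (l & u & v & Hl & [Hin Hbad] & Hp & Hq).
    { apply Rdiv_lt_0_compat; lra. }
    assert (Hld : l * (h0 + k0) < d).
    { replace d with (d / (h0 + k0) * (h0 + k0)) by (field; lra).
      apply Rmult_lt_compat_r; lra. }
    assert (0 < l * h0) by nra. assert (0 < l * k0) by nra.
    specialize (Hloc u v (l * h0) (l * k0) ltac:(lra) ltac:(lra) Hin Hp Hq).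
    assert (E : 2 * e' * (l * h0 + l * k0) * (l * h0 + l * k0)
      = e * (l * h0 * (l * k0)) / 2) by (unfold e'; field; lra).
    assert (0 < l * h0 * (l * k0)) by (apply Rmult_lt_0_compat; lra).
    assert (0 < e * (l * h0 * (l * k0))) by (apply Rmult_lt_0_compat; lra).
    lra.
Qed.

End Goursat.

(** * Mean values and the maximum principle *)

Lemma Cmod_le_Rabs_plus (z : C) : Cmod z <= Rabs (Re z) + Rabs (Im z).
Proof.
  replace z with (RtoC (Re z) + Ci * RtoC (Im z))%C at 1
    by (unfold Re, Im; destruct z as [a b]; unfold Cplus, Cmult; simpl; f_equal; ring).
  eapply Rle_trans; [apply Cmod_triangle|].
  rewrite Cmod_mult, Cmod_Ci, !Cmod_R; lra.
Qed.

(** The Cauchy-Riemann equations, read off from the complex first-order expansion. *)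
Lemma differentiable_C_re_im (f : C -> C) (z : C) :
  differentiable_C f z -> exists a b,
    differentiable_pt_lim (fun x y => Re (f (x, y))) (Re z) (Im z) a (- b) /\
    differentiable_pt_lim (fun x y => Im (f (x, y))) (Re z) (Im z) b a.
Proof.
  intros Hf; assert (H := differentiable_C_eps f z Hf); destruct (C_derive f z) as [a b].
  destruct z as [x y]; exists a, b; simpl.
  assert (HC : forall e : posreal, locally_2d (fun u v =>
    Cmod (f (u, v) - f (x, y) - ((u, v) - (x, y)) * (a, b))
      <= e * Rmax (Rabs (u - x)) (Rabs (v - y))) x y).
  { intros e; destruct (H (e / 2)) as (d & Hd & Hy).
    { generalize (cond_pos e); lra. }
    assert (Hd2 : 0 < d / 2) by lra.
    exists (mkposreal _ Hd2); simpl; intros u v Hu Hv.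
    assert (Hm := Cmod_le_Rabs_plus ((u, v) - (x, y))%C).
    change (Re ((u, v) - (x, y))%C) with (u - x) in Hm.
    change (Im ((u, v) - (x, y))%C) with (v - y) in Hm.
    eapply Rle_trans; [apply Hy; lra|].
    assert (H1 := Rmax_l (Rabs (u - x)) (Rabs (v - y))).
    assert (H2 := Rmax_r (Rabs (u - x)) (Rabs (v - y))).
    replace (e * Rmax (Rabs (u - x)) (Rabs (v - y)))
      with (e / 2 * (2 * Rmax (Rabs (u - x)) (Rabs (v - y)))) by field.
    apply Rmult_le_compat_l; [generalize (cond_pos e); lra | lra]. }
  split; intros e; destruct (HC e) as [d Hd]; exists d; intros u v Hu Hv;
    eapply Rle_trans; [| exact (Hd u v Hu Hv) | | exact (Hd u v Hu Hv)].
  - eapply Rle_trans; [|apply re_le_Cmod]; right; f_equal.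
    unfold Re, Cminus, Cplus, Cmult, Copp; simpl; ring.
  - eapply Rle_trans; [|eapply Rle_trans; [apply Rmax_r | apply Rmax_Cmod]]; right; f_equal.
    unfold Im, Cminus, Cplus, Cmult, Copp; simpl; ring.
Qed.

Lemma differentiable_pt_lim_mult (x y : R) :
  differentiable_pt_lim (fun u v => u * v) x y y x.
Proof.
  intros e; exists e; intros u v Hu Hv.
  replace (u * v - x * y - (y * (u - x) + x * (v - y))) with ((u - x) * (v - y)) by ring.
  rewrite Rabs_mult; apply Rmult_le_compat; [apply Rabs_pos | apply Rabs_pos | lra | apply Rmax_r].
Qed.

Lemma differentiable_pt_lim_proj2 (g : R -> R) (x y l : R) :
  derivable_pt_lim g y l -> differentiable_pt_lim (fun _ v => g v) x y 0 l.
Proof.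
  intros H e.
  destruct (differentiable_pt_lim_proj1_0 g y x l H e) as [d Hd].
  exists d; intros u v Hu Hv; rewrite Rmax_comm.
  replace (0 * (u - x) + l * (v - y)) with (l * (v - y) + 0 * (u - x)) by ring.
  now apply Hd.
Qed.

Definition polar (w : C) (r t : R) : C := (Re w + r * cos t, Im w + r * sin t).

Lemma Cmod_polar (w : C) (r t : R) : 0 <= r -> Cmod (polar w r t - w) = r.
Proof.
  intros Hr; unfold Cmod, polar, Re, Im; destruct w as [a b]; simpl.
  replace ((a + r * cos t + - a) * ((a + r * cos t + - a) * 1)
    + (b + r * sin t + - b) * ((b + r * sin t + - b) * 1))
    with (r * r * (Rsqr (sin t) + Rsqr (cos t))) by (unfold Rsqr; ring).
  rewrite sin2_cos2, Rmult_1_r; now apply sqrt_square.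
Qed.

Lemma differentiable_pt_lim_scal_plus (g : R -> R) (a r t l : R) :
  derivable_pt_lim g t l ->
  differentiable_pt_lim (fun u v => a + u * g v) r t (g t) (r * l).
Proof.
  intros H.
  assert (E := differentiable_pt_lim_comp (fun u v => u * v) (fun u _ => u)
    (fun _ v => g v) r t _ _ _ _ _ _ (differentiable_pt_lim_mult r (g t))
    (differentiable_pt_lim_proj1_0 _ r t _ (derivable_pt_lim_id r))
    (differentiable_pt_lim_proj2 g r t l H)).
  intros e; destruct (E e) as [d Hd]; exists d; intros u v Hu Hv.
  specialize (Hd u v Hu Hv); simpl in Hd.
  eapply Rle_trans; [right|exact Hd]; f_equal; ring.
Qed.

Lemma differentiable_pt_lim_polar (F : R -> R -> R) (w : C) (r t a b : R) :
  differentiable_pt_lim F (Re w + r * cos t) (Im w + r * sin t) a b ->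
  differentiable_pt_lim (fun r t => F (Re w + r * cos t) (Im w + r * sin t)) r t
    (a * cos t + b * sin t) (a * (r * - sin t) + b * (r * cos t)).
Proof.
  intros H; apply (differentiable_pt_lim_comp F _ _ r t a b); [exact H | |];
    apply differentiable_pt_lim_scal_plus;
    [apply derivable_pt_lim_cos | apply derivable_pt_lim_sin].
Qed.

(* The form [Re H dt + Im H dr / r] is closed, being the imaginary part of
   [H(z) dz / (z - w)] in polar coordinates around [w]. *)
Lemma polar_circulation (H : C -> C) (w : C) (r1 r2 c d : R) :
  0 < r1 < r2 -> c < d ->
  (forall r t, r1 <= r <= r2 -> c <= t <= d -> differentiable_C H (polar w r t)) ->
  RInt (fun t => Re (H (polar w r2 t)) - Re (H (polar w r1 t))) c d =
  RInt (fun r => (Im (H (polar w r d)) - Im (H (polar w r c))) / r) r1 r2.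
Proof.
  intros Hr Hcd HH.
  set (A := fun r t => Im (H (polar w r t)) * / r).
  set (B := fun r t => Re (H (polar w r t))).
  assert (Hdiff : forall r t, r1 <= r <= r1 + (r2 - r1) -> c <= t <= c + (d - c) ->
    exists a b e, differentiable_pt_lim A r t a b /\ differentiable_pt_lim B r t b e).
  { intros r t Hrr Ht.
    destruct (differentiable_C_re_im H _ (HH r t ltac:(lra) ltac:(lra))) as (a & b & HRe & HIm).
    assert (HB := differentiable_pt_lim_polar (fun x y => Re (H (x, y))) w r t _ _ HRe).
    assert (HI := differentiable_pt_lim_polar (fun x y => Im (H (x, y))) w r t _ _ HIm).
    assert (Hinv : differentiable_pt_lim (fun u _ => / u) r t (- / Rsqr r) 0).
    { apply differentiable_pt_lim_proj1_0.
      assert (E : is_derive Rinv r (- / Rsqr r)).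
      { auto_derive; [lra | unfold Rsqr; field; lra]. }
      now apply is_derive_Reals. }
    assert (HA := differentiable_pt_lim_comp (fun u v => u * v) _ _ r t _ _ _ _ _ _
      (differentiable_pt_lim_mult _ _) HI Hinv).
    simpl in HA.
    (* The polar Cauchy-Riemann equation: the derivative of [Re H] in [r] is that of [Im H] in [t]
       divided by [r]. It supplies the coefficient that Goursat's theorem requires to be common. *)
    eexists _, (a * cos t + - b * sin t), _; split; [|exact HB].
    match type of HA with differentiable_pt_lim _ _ _ _ ?l =>
      replace (a * cos t + - b * sin t) with l; [exact HA | field; lra] end. }
  assert (HAc : forall s t, r1 <= s <= r1 + (r2 - r1) -> c <= t <= c + (d - c) ->
    continuity_2d_pt A s t).
  { intros s t Hs Ht; destruct (Hdiff s t Hs Ht) as (? & ? & ? & E & _).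
    exact (differentiable_pt_lim_continuity_2d _ _ _ _ _ E). }
  assert (HBc : forall s t, r1 <= s <= r1 + (r2 - r1) -> c <= t <= c + (d - c) ->
    continuity_2d_pt B s t).
  { intros s t Hs Ht; destruct (Hdiff s t Hs Ht) as (? & ? & ? & _ & E).
    exact (differentiable_pt_lim_continuity_2d _ _ _ _ _ E). }
  assert (E := circulation_eq_0 A B r1 c (r2 - r1) (d - c) HAc HBc Hdiff
    ltac:(lra) ltac:(lra)).
  unfold circulation in E.
  replace (r1 + (r2 - r1)) with r2 in E by ring.
  replace (c + (d - c)) with d in E by ring.
  replace (RInt (fun s => A s c - A s d) r1 r2)
    with (- RInt (fun r => (Im (H (polar w r d)) - Im (H (polar w r c))) / r) r1 r2) in E.
  - unfold B in E; lra.
  - rewrite <- (RInt_opp (V := R_CompleteNormedModule)).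
    + apply RInt_ext; intros r _; unfold A, opp; simpl; unfold Rdiv.
      match goal with |- ?a = ?b => change (@eq R a b) end; ring.
    + apply (ex_RInt_ext (fun s => A s d - A s c)).
      { intros r _; unfold A, Rdiv; match goal with |- ?a = ?b => change (@eq R a b) end; ring. }
      apply (ex_RInt_continuous (V := R_CompleteNormedModule)); intros s.
      rewrite Rmin_left, Rmax_right by lra; intros Hs.
      apply (continuous_minus (V := R_NormedModule) (fun s => A s d) (fun s => A s c));
        apply continuity_2d_pt_1, HAc; lra.
Qed.

Lemma differentiable_C_continuous_Re_polar (H : C -> C) (w : C) (r t : R) :
  differentiable_C H (polar w r t) -> continuous (fun t => Re (H (polar w r t))) t.
Proof.
  intros Hd; destruct (differentiable_C_re_im H _ Hd) as (a & b & HRe & _).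
  assert (HB := differentiable_pt_lim_polar (fun x y => Re (H (x, y))) w r t _ _ HRe).
  exact (continuity_2d_pt_2 (fun r t => Re (H (polar w r t))) _ _
    (differentiable_pt_lim_continuity_2d _ _ _ _ _ HB)).
Qed.

(* [w] may be a singularity of [H]: only continuity is required there. *)
Lemma mean_value_le (H : C -> C) (w : C) (r m : R) :
  0 < r -> continuous_C H w ->
  (forall z, 0 < Cmod (z - w) <= r -> differentiable_C H z) ->
  (forall z, Cmod (z - w) = r -> Re (H z) <= m) -> Re (H w) <= m.
Proof.
  intros Hr Hc Hd Hm; apply Rnot_lt_le; intros Hlt.
  set (e := Re (H w) - m).
  destruct (proj1 (continuous_C_eps H w) Hc (e / 2)) as (d & Hd0 & Hy); [unfold e; lra|].
  set (r1 := Rmin (d / 2) (r / 2)).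
  assert (H1 : 0 < r1) by (unfold r1; apply Rmin_pos; lra).
  assert (H2 : r1 <= d / 2) by apply Rmin_l.
  assert (H3 : r1 <= r / 2) by apply Rmin_r.
  assert (Hpi := PI_RGT_0).
  assert (Hdp : forall s t, r1 <= s <= r -> differentiable_C H (polar w s t)).
  { intros s t Hs; apply Hd; rewrite Cmod_polar; lra. }
  assert (E := polar_circulation H w r1 r 0 (2 * PI) ltac:(lra) ltac:(lra)
    (fun s t Hs _ => Hdp s t Hs)).
  (* After a full turn the two radii coincide, so the integral of [Re H] over the circle is the same
     for both radii. On the small circle [Re H] exceeds [m + e / 2] by continuity at [w], on the
     large one it is at most [m]. *)
  rewrite (RInt_ext _ (fun _ => 0) r1 r) in E.
  2: { intros s _; unfold polar; rewrite cos_2PI, sin_2PI, cos_0, sin_0.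
       unfold Rdiv; rewrite Rminus_diag.
       match goal with |- ?a = ?b => change (@eq R a b) end; ring. }
  rewrite RInt_const in E; unfold scal in E; simpl in E; unfold mult in E; simpl in E.
  rewrite Rmult_0_r in E.
  assert (Hle : RInt (fun t => Re (H (polar w r t)) - Re (H (polar w r1 t))) 0 (2 * PI)
    <= RInt (fun _ => - (e / 2)) 0 (2 * PI)).
  { apply RInt_le; [lra | | apply ex_RInt_const |].
    - apply (ex_RInt_continuous (V := R_CompleteNormedModule)); intros t _.
      apply (continuous_minus (V := R_NormedModule) (fun t => Re (H (polar w r t)))
        (fun t => Re (H (polar w r1 t))));
        apply differentiable_C_continuous_Re_polar, Hdp; lra.
    - intros t _.
      assert (Re (H (polar w r t)) <= m) by (apply Hm; rewrite Cmod_polar; lra).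
      assert (Hn := Hy (polar w r1 t)); rewrite Cmod_polar in Hn by lra.
      specialize (Hn ltac:(lra)).
      assert (Hre := re_le_Cmod (H (polar w r1 t) - H w)).
      assert (Hre' : Rabs (Re (H (polar w r1 t) - H w)) < e / 2) by lra.
      apply Rabs_lt_between in Hre'.
      change (Re (H (polar w r1 t) - H w)) with (Re (H (polar w r1 t)) - Re (H w)) in Hre'.
      unfold e in *; lra. }
  rewrite RInt_const in Hle; unfold scal in Hle; simpl in Hle; unfold mult in Hle; simpl in Hle.
  assert (0 < 2 * PI * (e / 2)) by (apply Rmult_lt_0_compat; unfold e; lra).
  lra.
Qed.

(** The bisection keeps the property that every value on the disc is dominated by one taken in the
    rectangle. If all four quarters lost it, the best of their four witnesses would contradict it
    for the rectangle. The side [2 * r + 1] remains positive when [r = 0]. *)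
Lemma closed_disc_argmax (v : C -> R) (r : R) :
  0 <= r ->
  (forall z, Cmod z <= r -> forall e, 0 < e -> exists d, 0 < d /\
    forall y, Cmod (y - z) < d -> Rabs (v y - v z) < e) ->
  exists p, Cmod p <= r /\ forall z, Cmod z <= r -> v z <= v p.
Proof.
  intros Hr Hv.
  set (inside := fun (x y h k : R) (z : C) =>
    Cmod z <= r /\ x <= Re z <= x + h /\ y <= Im z <= y + k).
  destruct (rectangle_bisection (fun x y h k => forall z, Cmod z <= r ->
    exists z', inside x y h k z' /\ v z <= v z')
    (- r) (- r) (2 * r + 1) (2 * r + 1)) as (p & q & Hpq); try lra.
  - intros z Hz; exists z; split; [|lra].
    assert (H1 := re_le_Cmod z).
    assert (H2 := Rle_trans _ _ _ (Rmax_r _ _) (Rmax_Cmod z)).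
    assert (H3 : Rabs (Re z) <= r) by lra; assert (H4 : Rabs (Im z) <= r) by (unfold Im; lra).
    apply Rabs_le_between in H3; apply Rabs_le_between in H4; repeat split; lra.
  - intros x y h k Hh Hk HQ; apply NNPP; intros Hno.
    assert (Hwit : forall x' y', ~ (forall z, Cmod z <= r ->
      exists z', inside x' y' (h / 2) (k / 2) z' /\ v z <= v z') ->
      exists z, Cmod z <= r /\ forall z', inside x' y' (h / 2) (k / 2) z' -> v z' < v z).
    { intros x' y' Hn; apply not_all_ex_not in Hn; destruct Hn as [z Hn].
      apply imply_to_and in Hn; destruct Hn as [Hz Hn]; exists z; split; [exact Hz|].
      intros z' Hz'; apply Rnot_le_lt; intros Hle; apply Hn; now exists z'. }
    assert (Hmax : forall z1 z2, Cmod z1 <= r -> Cmod z2 <= r ->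
      exists z, Cmod z <= r /\ v z1 <= v z /\ v z2 <= v z).
    { intros z1 z2 Hz1 Hz2; destruct (Rle_lt_dec (v z1) (v z2));
        [exists z2 | exists z1]; repeat split; lra. }
    apply not_or_and in Hno; destruct Hno as [N1 Hno].
    apply not_or_and in Hno; destruct Hno as [N2 Hno].
    apply not_or_and in Hno; destruct Hno as [N3 N4].
    destruct (Hwit _ _ N1) as (z1 & Hz1 & W1); destruct (Hwit _ _ N2) as (z2 & Hz2 & W2).
    destruct (Hwit _ _ N3) as (z3 & Hz3 & W3); destruct (Hwit _ _ N4) as (z4 & Hz4 & W4).
    destruct (Hmax z1 z2 Hz1 Hz2) as (z12 & Hz12 & M1 & M2).
    destruct (Hmax z3 z4 Hz3 Hz4) as (z34 & Hz34 & M3 & M4).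
    destruct (Hmax z12 z34 Hz12 Hz34) as (z & Hz & M5 & M6).
    destruct (HQ z Hz) as (z' & (Hz' & Hx & Hy) & Hle).
    destruct (Rle_lt_dec (Re z') (x + h / 2)); destruct (Rle_lt_dec (Im z') (y + k / 2)).
    + specialize (W1 z' ltac:(unfold inside; lra)); lra.
    + specialize (W3 z' ltac:(unfold inside; lra)); lra.
    + specialize (W2 z' ltac:(unfold inside; lra)); lra.
    + specialize (W4 z' ltac:(unfold inside; lra)); lra.
  - assert (Hnear : forall z d, Cmod z <= r -> 0 < d ->
      exists z', Cmod z' <= r /\ Cmod (z' - (p, q)) < d /\ v z <= v z').
    { intros z d Hz Hd.
      destruct (Hpq (d / (4 * r + 2))) as (l & u & w & Hl & HQ & Hp & Hq).
      { apply Rdiv_lt_0_compat; lra. }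
      assert (Hlr : l * (4 * r + 2) < d).
      { replace d with (d / (4 * r + 2) * (4 * r + 2)) by (field; lra).
        apply Rmult_lt_compat_r; lra. }
      destruct (HQ z Hz) as (z' & (Hz' & Hx & Hy) & Hle).
      exists z'; repeat split; try assumption.
      eapply Rle_lt_trans; [apply Cmod_le_Rabs_plus|].
      change (Re (z' - (p, q))%C) with (Re z' - p).
      change (Im (z' - (p, q))%C) with (Im z' - q).
      assert (Rabs (Re z' - p) <= l * (2 * r + 1)) by (apply Rabs_le; lra).
      assert (Rabs (Im z' - q) <= l * (2 * r + 1)) by (apply Rabs_le; lra).
      lra. }
    assert (Hp : Cmod (p, q) <= r).
    { apply Rnot_lt_le; intros Hlt.
      destruct (Hnear (RtoC 0) (Cmod (p, q) - r)) as (z' & Hz' & Hd & _);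
        [rewrite Cmod_0; lra | lra |].
      generalize (Cmod_triangle_rev (p, q) z'); rewrite Cmod_minus_sym; lra. }
    exists (p, q); split; [exact Hp|]; intros z Hz.
    apply Rnot_lt_le; intros Hlt.
    destruct (Hv (p, q) Hp (v z - v (p, q))) as (d & Hd & Hy); [lra|].
    destruct (Hnear z d Hz Hd) as (z' & Hz' & Hzd & Hle).
    specialize (Hy z' Hzd); apply Rabs_lt_between in Hy; lra.
Qed.

Lemma Cmod_plus_sqr (p z : C) :
  Cmod (p + z) ^ 2 = Cmod p ^ 2 + 2 * Re (Cconj p * z) + Cmod z ^ 2.
Proof.
  rewrite !Cmod2_alt; destruct p as [a b], z as [x y].
  unfold Re, Im, Cconj, Cplus, Cmult; simpl; ring.
Qed.

(* Perturbing [Cmod (h z)] by [eta * Cmod z ^ 2] makes the mean value inequality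
   strict, so that the maximum is not attained inside the disc. *)
Lemma maximum_principle (h : C -> C) :
  (forall z, Cmod z < 1 -> continuous_C h z) ->
  (forall z, Cmod z < 1 -> exists d, 0 < d /\
    forall y, 0 < Cmod (y - z) < d -> differentiable_C h y) ->
  (forall e, 0 < e -> exists r, r < 1 /\ forall z, r <= Cmod z < 1 -> Cmod (h z) <= 1 + e) ->
  forall z, Cmod z < 1 -> Cmod (h z) <= 1.
Proof.
  intros Hc Hd Hb z0 Hz0; apply Rnot_lt_le; intros Hlt.
  (* So [Cmod (h z0) = 1 + 3 * e]. The perturbation costs at most [e], hence
     [Cmod (h p) >= 1 + 2 * e] at the maximum point, which exceeds the bound [1 + e] near the circle
     and keeps [p] inside. *)
  set (e := (Cmod (h z0) - 1) / 3).
  assert (He : 0 < e) by (unfold e; lra).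
  destruct (Hb e He) as (r0 & Hr0 & Hbd).
  set (r := Rmax r0 (Cmod z0)).
  assert (Hr0r : r0 <= r) by apply Rmax_l.
  assert (Hz0r : Cmod z0 <= r) by apply Rmax_r.
  assert (Hr1 : r < 1) by (apply Rmax_lub_lt; lra).
  assert (Hr : 0 <= r) by (eapply Rle_trans; [apply (Cmod_ge_0 z0) | exact Hz0r]).
  set (v := fun z => Cmod (h z) + e * Cmod z ^ 2).
  destruct (closed_disc_argmax v r Hr) as (p & Hp & Hmax).
  { intros z Hz e' He'.
    destruct (proj1 (continuous_C_eps h z) (Hc z ltac:(lra)) (e' / 2)) as (d & Hd0 & Hy); [lra|].
    assert (Hq : 0 < e' / 2 / (3 * e)) by (apply Rdiv_lt_0_compat; lra).
    exists (Rmin d (Rmin 1 (e' / 2 / (3 * e)))); split; [repeat apply Rmin_pos; lra|].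
    intros y Hyz.
    assert (H1 := Rmin_l d (Rmin 1 (e' / 2 / (3 * e)))).
    assert (H2 := Rmin_r d (Rmin 1 (e' / 2 / (3 * e)))).
    assert (H3 := Rmin_l 1 (e' / 2 / (3 * e))).
    assert (H4 := Rmin_r 1 (e' / 2 / (3 * e))).
    specialize (Hy y ltac:(lra)).
    assert (T1 := Cmod_triangle_rev (h y) (h z)).
    assert (T2 := Cmod_triangle_rev (h z) (h y)).
    assert (T3 := Cmod_triangle_rev y z).
    assert (T4 := Cmod_triangle_rev z y).
    rewrite Cmod_minus_sym in T2; rewrite (Cmod_minus_sym z y) in T4.
    assert (Hyq : Cmod (y - z) * (3 * e) < e' / 2).
    { replace (e' / 2) with (e' / 2 / (3 * e) * (3 * e)) by (field; lra).
      apply Rmult_lt_compat_r; lra. }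
    assert (P1 := Cmod_ge_0 y); assert (P2 := Cmod_ge_0 z); assert (P3 := Cmod_ge_0 (y - z)).
    assert (E1 : Rabs (e * (Cmod y ^ 2 - Cmod z ^ 2)) <= Cmod (y - z) * (3 * e)).
    { rewrite Rabs_mult, (Rabs_pos_eq e) by lra.
      replace (Cmod y ^ 2 - Cmod z ^ 2) with ((Cmod y - Cmod z) * (Cmod y + Cmod z)) by ring.
      rewrite Rabs_mult, (Rabs_pos_eq (Cmod y + Cmod z)) by lra.
      assert (Rabs (Cmod y - Cmod z) <= Cmod (y - z)) by (apply Rabs_le; lra).
      assert (Rabs (Cmod y - Cmod z) * (Cmod y + Cmod z) <= Cmod (y - z) * 3).
      { apply Rmult_le_compat; [apply Rabs_pos | lra | assumption | lra]. }
      replace (Cmod (y - z) * (3 * e)) with (e * (Cmod (y - z) * 3)) by ring.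
      apply Rmult_le_compat_l; lra. }
    apply Rabs_le_between in E1; unfold v; apply Rabs_lt_between; lra. }
  assert (Hv0 := Hmax z0 Hz0r); unfold v in Hv0.
  assert (Hz0' := pow2_ge_0 (Cmod z0)).
  assert (Hpp := Cmod_ge_0 p).
  assert (Hp2 : Cmod p ^ 2 <= 1) by nra.
  assert (Hhp : 1 + 2 * e <= Cmod (h p)).
  { assert (0 <= e * Cmod z0 ^ 2) by nra. assert (e * Cmod p ^ 2 <= e) by nra.
    unfold e in *; lra. }
  assert (Hpr : Cmod p < r).
  { apply Rnot_le_lt; intros Hle; specialize (Hbd p ltac:(lra)); lra. }
  destruct (Hd p ltac:(lra)) as (d & Hd0 & Hdiff).
  set (rho := Rmin (d / 2) (r - Cmod p)).
  assert (R1 : 0 < rho) by (apply Rmin_pos; lra).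
  assert (R2 : rho <= d / 2) by apply Rmin_l.
  assert (R3 : rho <= r - Cmod p) by apply Rmin_r.
  (* The factor [a] rotates [h p] to its modulus. The term [b * (z - p)] has as real part the linear
     part of [e * Cmod z ^ 2] around [p], so adding it leaves only [- e * rho ^ 2] from the
     perturbation on the circle of radius [rho], while nothing changes at the centre. *)
  set (a := (Cconj (h p) * RtoC (/ Cmod (h p)))%C).
  set (b := (RtoC (2 * e) * Cconj p)%C).
  assert (Ha : Cmod a = 1).
  { unfold a; rewrite Cmod_mult, Cmod_conj, Cmod_R, Rabs_pos_eq.
    - apply Rinv_r; lra.
    - apply Rlt_le, Rinv_0_lt_compat; lra. }
  assert (Hap : (a * h p)%C = RtoC (Cmod (h p))).
  { unfold a; replace (Cconj (h p) * RtoC (/ Cmod (h p)) * h p)%C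
      with (h p * Cconj (h p) * RtoC (/ Cmod (h p)))%C by ring.
    rewrite <- Cmod2_conj, <- RtoC_mult; f_equal; field; lra. }
  assert (Hmv : Re (a * h p + b * (p - p)) <= Cmod (h p) - e * rho ^ 2).
  { apply (mean_value_le (fun z => a * h z + b * (z + - p))%C p rho); [exact R1 | | |].
    - apply continuous_C_plus; apply continuous_C_mult; try apply continuous_C_const.
      + apply Hc; lra.
      + apply continuous_C_plus; [apply continuous_C_id | apply continuous_C_const].
    - intros z Hz.
      apply differentiable_C_plus; apply differentiable_C_mult.
      + apply differentiable_C_const.
      + apply Hdiff; lra.
      + apply differentiable_C_const.
      + apply differentiable_C_plus; [apply differentiable_C_id | apply differentiable_C_const].
    - intros z Hz.
      assert (Hzr : Cmod z <= r) by (generalize (Cmod_triangle_rev z p); lra).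
      assert (Hvz := Hmax z Hzr); unfold v in Hvz.
      assert (Hsq := Cmod_plus_sqr p (z - p)).
      replace (p + (z - p))%C with z in Hsq by ring; rewrite Hz in Hsq.
      assert (H1 := re_le_Cmod (a * h z)); rewrite Cmod_mult, Ha, Rmult_1_l in H1.
      assert (H2 := Rle_abs (Re (a * h z))).
      rewrite re_plus; change (z + - p)%C with (z - p)%C.
      unfold b; rewrite <- Cmult_assoc, re_scal_l.
      nra. }
  rewrite Hap in Hmv.
  replace (RtoC (Cmod (h p)) + b * (p - p))%C with (RtoC (Cmod (h p))) in Hmv by ring.
  simpl in Hmv.
  assert (0 < e * (rho * rho)) by (repeat apply Rmult_lt_0_compat; lra).
  lra.
Qed.

(** * Schwarz-Pick inequality *)

(** This is the formula for [1 - |phi|^2], where [phi = (z - a) / (1 - conj a z)] is a disc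
    automorphism, with denominators cleared. *)
Lemma Cmod_moebius (a z : C) :
  Cmod (1 - Cconj a * z) ^ 2 = Cmod (z - a) ^ 2 + (1 - Cmod z ^ 2) * (1 - Cmod a ^ 2).
Proof.
  rewrite !Cmod2_alt; destruct a as [a b], z as [x y].
  unfold Re, Im, Cconj, Cminus, Cplus, Copp, Cmult; simpl; ring.
Qed.

Lemma pow2_le_reg (x y : R) : 0 <= y -> x ^ 2 <= y ^ 2 -> x <= y.
Proof. intros Hy H; apply Rnot_lt_le; intros Hlt; nra. Qed.

Lemma Cmod_1_minus_conj_ge (a z : C) : 1 - Cmod a * Cmod z <= Cmod (1 - Cconj a * z).
Proof.
  generalize (Cmod_triangle_rev 1 (Cconj a * z)).
  now rewrite Cmod_1, Cmod_mult, Cmod_conj.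
Qed.

(** Schwarz's lemma: the quotient has modulus at most [1 / Cmod z], which is at most [1 + e] as soon
    as [Cmod z >= / (1 + e)]. *)
Lemma schwarz_slope (f : C -> C) :
  analytic_on_disc f -> (forall z, unit_disc z -> Cmod (f z) < 1) -> f (RtoC 0) = RtoC 0 ->
  forall z, Cmod z < 1 -> Cmod (slope f (RtoC 0) z) <= 1.
Proof.
  intros Hf Hlt H0.
  assert (Hz : forall z, 0 < Cmod z -> z <> RtoC 0).
  { intros z Hz ->; rewrite Cmod_0 in Hz; lra. }
  apply maximum_principle.
  - intros z Hz1; destruct (Ceq_dec z (RtoC 0)) as [->|n].
    + apply slope_continuous, Hf; exact Hz1.
    + apply slope_continuous_off; [exact n|].
      apply differentiable_C_continuous, Hf; exact Hz1.
  - intros z Hz1; destruct (Ceq_dec z (RtoC 0)) as [->|n].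
    + exists 1; split; [lra|]; intros y Hy.
      replace (y - RtoC 0)%C with y in Hy by ring.
      apply slope_differentiable_off; [apply Hz; lra | apply Hf, Hy].
    + apply Cmod_gt_0 in n.
      exists (Rmin (Cmod z) (1 - Cmod z)); split; [apply Rmin_pos; lra|]; intros y Hy.
      assert (H1 := Rmin_l (Cmod z) (1 - Cmod z)); assert (H2 := Rmin_r (Cmod z) (1 - Cmod z)).
      assert (H3 := Cmod_triangle_rev y z); assert (H4 := Cmod_triangle_rev z y).
      rewrite Cmod_minus_sym in H4.
      apply slope_differentiable_off; [apply Hz; lra | apply Hf; unfold unit_disc; lra].
  - intros e He; exists (/ (1 + e)); split.
    { rewrite <- Rinv_1 at 2; apply Rinv_lt_contravar; lra. }
    intros z Hz1.
    assert (Hi : 0 < / (1 + e)) by (apply Rinv_0_lt_compat; lra).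
    assert (E : Cmod (f z) = Cmod z * Cmod (slope f (RtoC 0) z)).
    { rewrite <- Cmod_mult; f_equal.
      generalize (slope_eq f (RtoC 0) z); rewrite H0; intros E.
      replace (z - RtoC 0)%C with z in E by ring; rewrite <- E; ring. }
    specialize (Hlt z ltac:(apply Hz1)).
    assert (H1 : 1 <= Cmod z * (1 + e)).
    { rewrite <- (Rinv_l (1 + e)) at 1 by lra; apply Rmult_le_compat_r; lra. }
    assert (Hg := Cmod_ge_0 (slope f (RtoC 0) z)); nra.
Qed.

(* [g] need not be differentiable at [0]: it will be [f z / z]. *)
Lemma schwarz_pick_at_0 (g : C -> C) (l : R) :
  (forall z, Cmod z < 1 -> continuous_C g z) ->
  (forall z, 0 < Cmod z < 1 -> differentiable_C g z) ->
  l < 1 -> (forall z, Cmod z < 1 -> Cmod (g z) <= l) ->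
  forall w, 0 < Cmod w < 1 ->
  Cmod (g (RtoC 0) - g w) <= Cmod w * Cmod (1 - Cconj (g w) * g (RtoC 0)).
Proof.
  intros Hc Hd Hl Hg w Hw.
  assert (Hden : forall z, Cmod z < 1 -> 0 < Cmod (1 - Cconj (g w) * g z)).
  { intros z Hz; eapply Rlt_le_trans; [|apply Cmod_1_minus_conj_ge].
    assert (H1 := Hg z Hz); assert (H2 := Hg w ltac:(lra)).
    assert (H3 := Cmod_ge_0 (g z)); assert (H4 := Cmod_ge_0 (g w)); nra. }
  assert (Hden' : forall z, Cmod z < 1 -> (1 + - Cconj (g w) * g z)%C <> RtoC 0).
  { intros z Hz; specialize (Hden z Hz); apply Cmod_pos_neq.
    replace (1 + - Cconj (g w) * g z)%C with (1 - Cconj (g w) * g z)%C by ring; exact Hden. }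
  (* The Moebius quotient of [g z] and [g w] divided by that of [z] and [w], continued across [w] by
     the slope. The claim is [Cmod (k 0) <= 1]; the possible exceptional points are [w] and [0]. *)
  set (k := fun z => (slope g w z * ((1 + - Cconj w * z) * / (1 + - Cconj (g w) * g z)))%C).
  assert (Hk : Cmod (k (RtoC 0)) <= 1).
  { apply maximum_principle; [| | |rewrite Cmod_0; lra].
    - intros z Hz; unfold k.
      apply continuous_C_mult; [|apply continuous_C_mult; [|apply continuous_C_inv]].
      + destruct (Ceq_dec z w) as [->|n]; [apply slope_continuous, Hd; lra|].
        apply slope_continuous_off; [exact n | now apply Hc].
      + apply continuous_C_plus; [apply continuous_C_const|].
        apply continuous_C_mult; [apply continuous_C_const | apply continuous_C_id].
      + apply continuous_C_plus; [apply continuous_C_const|].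
        apply continuous_C_mult; [apply continuous_C_const | now apply Hc].
      + now apply Hden'.
    - intros z Hz.
      assert (Hiso : forall a, exists d, 0 < d /\
        forall y, 0 < Cmod (y - z) < d -> y <> a).
      { intros a; destruct (Ceq_dec a z) as [->|n].
        - exists 1; split; [lra|]; intros y Hy ->.
          replace (z - z)%C with (RtoC 0) in Hy by ring; rewrite Cmod_0 in Hy; lra.
        - exists (Cmod (a - z)); split; [now apply Cmod_gt_0, Cminus_neq_0|].
          intros y Hy ->; lra. }
      destruct (Hiso w) as (d1 & Hd1 & I1); destruct (Hiso (RtoC 0)) as (d2 & Hd2 & I2).
      exists (Rmin (1 - Cmod z) (Rmin d1 d2)); split; [repeat apply Rmin_pos; lra|].
      intros y Hy.
      assert (M1 := Rmin_l (1 - Cmod z) (Rmin d1 d2)).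
      assert (M2 := Rmin_r (1 - Cmod z) (Rmin d1 d2)).
      assert (M3 := Rmin_l d1 d2); assert (M4 := Rmin_r d1 d2).
      assert (Hy1 : Cmod y < 1) by (generalize (Cmod_triangle_rev y z); lra).
      assert (Hgy : differentiable_C g y).
      { apply Hd; split; [apply Cmod_gt_0, I2; lra | exact Hy1]. }
      unfold k.
      apply differentiable_C_mult; [|apply differentiable_C_mult; [|apply differentiable_C_inv]].
      + apply slope_differentiable_off; [apply I1; lra | exact Hgy].
      + apply differentiable_C_plus; [apply differentiable_C_const|].
        apply differentiable_C_mult; [apply differentiable_C_const | apply differentiable_C_id].
      + apply differentiable_C_plus; [apply differentiable_C_const|].
        apply differentiable_C_mult; [apply differentiable_C_const | exact Hgy].
      + now apply Hden'.
    - intros e He.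
      (* A lower bound for [Cmod (z - w)] once [Cmod z >= (1 + Cmod w) / 2]. By [Cmod_moebius],
         [1 - Cmod z <= e * (d * d)] then makes the Moebius quotient of [z] and [w] at least
         [1 / (1 + e)] in modulus. *)
      set (d := (1 - Cmod w) / 2).
      assert (Hd0 : 0 < d) by (unfold d; lra).
      assert (Hed : 0 < e * (d * d)) by (repeat apply Rmult_lt_0_compat; lra).
      exists (Rmax ((1 + Cmod w) / 2) (1 - e * (d * d))).
      split; [apply Rmax_lub_lt; lra|]; intros z [Hz1 Hz2].
      assert (M1 := Rmax_l ((1 + Cmod w) / 2) (1 - e * (d * d))).
      assert (M2 := Rmax_r ((1 + Cmod w) / 2) (1 - e * (d * d))).
      assert (Hzw : d <= Cmod (z - w)) by (generalize (Cmod_triangle_rev z w); unfold d; lra).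
      assert (Hdz := Hden z Hz2).
      assert (E1 := Cmod_moebius w z); assert (E2 := Cmod_moebius (g w) (g z)).
      assert (B1 : Cmod (g z - g w) <= Cmod (1 - Cconj (g w) * g z)).
      { apply pow2_le_reg; [lra|].
        assert (H1 := Hg z Hz2); assert (H2 := Hg w ltac:(lra)).
        assert (H3 := Cmod_ge_0 (g z)); assert (H4 := Cmod_ge_0 (g w)).
        assert (0 <= 1 - Cmod (g z) ^ 2) by nra. assert (0 <= 1 - Cmod (g w) ^ 2) by nra.
        assert (0 <= (1 - Cmod (g z) ^ 2) * (1 - Cmod (g w) ^ 2)) by now apply Rmult_le_pos.
        lra. }
      assert (B2 : Cmod (1 - Cconj w * z) <= (1 + e) * Cmod (z - w)).
      { apply pow2_le_reg; [nra|]; rewrite E1.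
        assert (H1 : 0 <= 1 - Cmod z ^ 2 <= 2 * (e * (d * d))) by nra.
        assert (H2 : 0 <= 1 - Cmod w ^ 2 <= 1) by nra.
        assert (H3 : (1 - Cmod z ^ 2) * (1 - Cmod w ^ 2) <= 2 * (e * (d * d)) * 1)
          by (apply Rmult_le_compat; lra).
        assert (H4 : d * d <= Cmod (z - w) ^ 2) by nra.
        assert (H5 : e * (d * d) <= e * Cmod (z - w) ^ 2) by (apply Rmult_le_compat_l; lra).
        assert (0 <= e * e * Cmod (z - w) ^ 2) by (assert (0 <= e * e) by nra; nra).
        nra. }
      assert (E3 : Cmod (g z - g w) = Cmod (z - w) * Cmod (slope g w z))
        by (rewrite <- Cmod_mult; f_equal; apply slope_eq).
      unfold k.
      replace (1 + - Cconj (g w) * g z)%C with (1 - Cconj (g w) * g z)%C by ring.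
      replace (1 + - Cconj w * z)%C with (1 - Cconj w * z)%C by ring.
      rewrite !Cmod_mult, Cmod_inv by now apply Cmod_pos_neq.
      rewrite E3 in B1; clear E1 E2 E3.
      apply Rmult_le_reg_r with (Cmod (1 - Cconj (g w) * g z)); [exact Hdz|].
      rewrite !Rmult_assoc, Rinv_l, Rmult_1_r by lra.
      assert (Hs := Cmod_ge_0 (slope g w z)).
      apply Rle_trans with (Cmod (slope g w z) * ((1 + e) * Cmod (z - w)));
        [now apply Rmult_le_compat_l|].
      apply Rle_trans with ((1 + e) * (Cmod (z - w) * Cmod (slope g w z)));
        [right; ring | apply Rmult_le_compat_l; lra]. }
  unfold k in Hk.
  replace (1 + - Cconj w * 0)%C with (RtoC 1) in Hk by ring.
  replace (1 + - Cconj (g w) * g (RtoC 0))%C with (1 - Cconj (g w) * g (RtoC 0))%C in Hk by ring.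
  assert (Hd1 := Hden (RtoC 0) ltac:(rewrite Cmod_0; lra)).
  rewrite !Cmod_mult, Cmod_1, Rmult_1_l, Cmod_inv in Hk by now apply Cmod_pos_neq.
  rewrite slope_eq, Cmod_mult.
  replace (RtoC 0 - w)%C with (- w)%C by ring; rewrite Cmod_opp.
  apply Rmult_le_compat_l; [lra|].
  apply Rmult_le_reg_r with (/ Cmod (1 - Cconj (g w) * g (RtoC 0)));
    [now apply Rinv_0_lt_compat|].
  rewrite Rinv_r by lra; exact Hk.
Qed.

Lemma analytic_growth (f : C -> C) :
  analytic_on_disc f -> (forall z, unit_disc z -> Cmod (f z) < 1) -> f (RtoC 0) = RtoC 0 ->
  forall z, Cmod z < 1 ->
  Cmod (f z) * (1 + Cmod (C_derive f (RtoC 0)) * Cmod z)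
    <= Cmod z * (Cmod z + Cmod (C_derive f (RtoC 0))).
Proof.
  intros Hf Hlt H0 z Hz.
  destruct (Ceq_dec z (RtoC 0)) as [->|n]; [rewrite H0, Cmod_0; lra|].
  apply Cmod_gt_0 in n.
  set (g := slope f (RtoC 0)).
  assert (Hg : forall z, Cmod z < 1 -> Cmod (g z) <= 1) by now apply schwarz_slope.
  assert (Eg : Cmod (f z) = Cmod z * Cmod (g z)).
  { rewrite <- Cmod_mult; f_equal; unfold g.
    generalize (slope_eq f (RtoC 0) z); rewrite H0; intros E.
    replace (z - RtoC 0)%C with z in E by ring; rewrite <- E; ring. }
  assert (Eg0 : C_derive f (RtoC 0) = g (RtoC 0)).
  { unfold g, slope; now destruct (Ceq_dec (RtoC 0) (RtoC 0)). }
  rewrite Eg, Eg0.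
  assert (Ha : Cmod (g (RtoC 0)) <= 1) by (apply Hg; rewrite Cmod_0; lra).
  assert (HG := Hg z Hz).
  assert (Hgc : forall z, Cmod z < 1 -> continuous_C g z).
  { intros y Hy; unfold g; destruct (Ceq_dec y (RtoC 0)) as [->|ny].
    - apply slope_continuous, Hf; exact Hy.
    - apply slope_continuous_off; [exact ny|].
      apply differentiable_C_continuous, Hf; exact Hy. }
  assert (Hgd : forall z, 0 < Cmod z < 1 -> differentiable_C g z).
  { intros y [Hy1 Hy2]; apply slope_differentiable_off; [|apply Hf; exact Hy2].
    now apply Cmod_gt_0. }
  set (G := g z) in *; set (a := g (RtoC 0)) in *.
  assert (HX : Cmod (a - G) <= Cmod z * Cmod (1 - Cconj G * a)).
  { apply le_epsilon; intros e He.
    set (s := Rmin (e / 4) (1 / 2)).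
    assert (S1 : 0 < s) by (apply Rmin_pos; lra).
    assert (S2 : s <= e / 4) by apply Rmin_l.
    assert (S3 : s <= 1 / 2) by apply Rmin_r.
    set (l := 1 - s).
    assert (Hl : 1 / 2 <= l < 1) by (unfold l; lra).
    assert (H1 := schwarz_pick_at_0 (fun y => RtoC l * g y)%C l).
    lapply H1; [clear H1; intros H1|].
    2: { intros y Hy; apply continuous_C_mult; [apply continuous_C_const | now apply Hgc]. }
    lapply H1; [clear H1; intros H1|].
    2: { intros y Hy; apply differentiable_C_mult; [apply differentiable_C_const | now apply Hgd]. }
    specialize (H1 ltac:(lra)).
    lapply H1; [clear H1; intros H1|].
    2: { intros y Hy; rewrite Cmod_mult, Cmod_R, Rabs_pos_eq by lra.
         specialize (Hg y Hy); nra. }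
    specialize (H1 z (conj n Hz)); fold G a in H1; cbv beta in H1.
    replace (RtoC l * a - RtoC l * G)%C with (RtoC l * (a - G))%C in H1 by ring.
    rewrite Cmod_mult, Cmod_R, Rabs_pos_eq in H1 by lra.
    replace (1 - Cconj (RtoC l * G) * (RtoC l * a))%C
      with ((1 - Cconj G * a) + RtoC (1 - l * l) * (Cconj G * a))%C in H1.
    2: { rewrite Cmult_conj, RtoC_minus, RtoC_mult.
         replace (Cconj (RtoC l)) with (RtoC l)
           by (unfold Cconj, RtoC; simpl; now rewrite Ropp_0).
         ring. }
    assert (H2 := Cmod_triangle (1 - Cconj G * a) (RtoC (1 - l * l) * (Cconj G * a))).
    rewrite !Cmod_mult, Cmod_conj, Cmod_R, Rabs_pos_eq in H2 by nra.
    assert (H3 : Cmod G * Cmod a <= 1).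
    { rewrite <- (Rmult_1_r 1); apply Rmult_le_compat; try apply Cmod_ge_0; assumption. }
    assert (H4 : (1 - l * l) * (Cmod G * Cmod a) <= 2 * s).
    { apply Rle_trans with ((1 - l * l) * 1); [apply Rmult_le_compat_l; nra | unfold l; nra]. }
    assert (H5 : Cmod (a - G) <= 2).
    { eapply Rle_trans; [apply Cmod_triangle|]; rewrite Cmod_opp; lra. }
    assert (H6 : l * Cmod (a - G) <= Cmod z * (Cmod (1 - Cconj G * a) + 2 * s)).
    { eapply Rle_trans; [exact H1|]; apply Rmult_le_compat_l; lra. }
    unfold l in H6; nra. }
  assert (E := Cmod_moebius G a).
  assert (HY := Cmod_1_minus_conj_ge G a).
  assert (PG := Cmod_ge_0 G); assert (Pa := Cmod_ge_0 a).
  set (X := Cmod (a - G)) in *; set (Y := Cmod (1 - Cconj G * a)) in *.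
  assert (PX : 0 <= X) by apply Cmod_ge_0.
  set (r := Cmod z) in *.
  assert (HGa : Cmod G * Cmod a <= 1).
  { rewrite <- (Rmult_1_r 1); apply Rmult_le_compat; assumption. }
  assert (HX2 : X ^ 2 <= (r * Y) ^ 2) by (apply pow_incr; lra).
  assert (HY2 : (1 - Cmod G * Cmod a) ^ 2 <= Y ^ 2) by (apply pow_incr; lra).
  (* Eliminating [X] by [Cmod_moebius] gives [(1 - r^2) Y^2 <= (1 - |a|^2) (1 - |G|^2)]. The right
     side equals [(1 - |G||a|)^2 - (|G| - |a|)^2], and [Y] is at least [1 - |G||a|]. *)
  assert (H1 : Cmod G - Cmod a <= r * (1 - Cmod G * Cmod a)).
  { apply pow2_le_reg; [apply Rmult_le_pos; lra|].
    assert (H : (1 - r * r) * (1 - Cmod G * Cmod a) ^ 2 <= (1 - r * r) * Y ^ 2)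
      by (apply Rmult_le_compat_l; nra).
    nra. }
  replace (r * Cmod G * (1 + Cmod a * r)) with (r * (Cmod G * (1 + Cmod a * r))) by ring.
  apply Rmult_le_compat_l; [lra|].
  lra.
Qed.

(** * Boundary behaviour *)

Lemma Cmod_expi (t : R) : Cmod (expi t) = 1.
Proof.
  unfold Cmod, expi; simpl.
  replace (cos t * (cos t * 1) + sin t * (sin t * 1)) with (Rsqr (sin t) + Rsqr (cos t))
    by (unfold Rsqr; ring).
  rewrite sin2_cos2; apply sqrt_1.
Qed.

Lemma sin_sqr_le (x : R) : sin x ^ 2 <= x ^ 2.
Proof.
  assert (Hpos : forall y, 0 < y -> sin y ^ 2 <= y ^ 2).
  { intros y Hy; rewrite <- (pow2_abs (sin y)); apply pow_incr; split; [apply Rabs_pos|].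
    apply Rabs_le; split; [|apply Rlt_le, sin_lt_x, Hy].
    destruct (Rle_lt_dec y PI) as [H|H].
    - generalize (sin_ge_0 y ltac:(lra) H); lra.
    - generalize (SIN_bound y) PI2_1; lra. }
  destruct (Rtotal_order x 0) as [H|[->|H]].
  - generalize (Hpos (- x) ltac:(lra)); rewrite sin_neg; nra.
  - rewrite sin_0; lra.
  - auto.
Qed.

Lemma Cmod_expi_minus_le (x y : R) : Cmod (expi x - expi y) <= Rabs (x - y).
Proof.
  apply pow2_le_reg; [apply Rabs_pos|].
  rewrite pow2_abs, Cmod2_alt.
  change (Re (expi x - expi y)) with (cos x - cos y).
  change (Im (expi x - expi y)) with (sin x - sin y).
  assert (H1 := sin2_cos2 x); assert (H2 := sin2_cos2 y); unfold Rsqr in H1, H2.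
  assert (H3 := cos_minus x y).
  assert (H4 := sin_sqr_le ((x - y) / 2)).
  assert (H5 := cos_2a_sin ((x - y) / 2)).
  replace (2 * ((x - y) / 2)) with (x - y) in H5 by field.
  nra.
Qed.

Lemma polar_0 (r t : R) : polar (RtoC 0) r t = (RtoC r * expi t)%C.
Proof.
  unfold polar, expi, RtoC, Cmult, Re, Im; simpl; f_equal; ring.
Qed.

Lemma Cmod_polar_0 (r t : R) : 0 <= r -> Cmod (polar (RtoC 0) r t) = r.
Proof.
  intros Hr; rewrite polar_0, Cmod_mult, Cmod_expi, Cmod_R, Rabs_pos_eq; lra.
Qed.

Lemma Cmod_polar_0_expi_le (r t u : R) :
  r <= 1 -> Cmod (polar (RtoC 0) r t - expi u) <= 1 - r + Rabs (t - u).
Proof.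
  intros Hr; rewrite polar_0.
  replace (RtoC r * expi t - expi u)%C
    with (RtoC (r - 1) * expi t + (expi t - expi u))%C by (rewrite RtoC_minus; ring).
  eapply Rle_trans; [apply Cmod_triangle|].
  rewrite Cmod_mult, Cmod_expi, Cmod_R, Rabs_left1 by lra.
  generalize (Cmod_expi_minus_le t u); lra.
Qed.

Lemma Re_cayley (s : C) :
  (1 + s)%C <> RtoC 0 -> Re ((1 - s) / (1 + s)) * Cmod (1 + s) ^ 2 = 1 - Cmod s ^ 2.
Proof.
  intros Hs; rewrite <- re_scal_r, Cmod2_conj.
  replace ((1 - s) / (1 + s) * ((1 + s) * Cconj (1 + s)))%C
    with ((1 - s) * Cconj (1 + s))%C by (field; exact Hs).
  rewrite Cmod2_alt; destruct s as [x y].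
  unfold Re, Im, Cconj, Cminus, Cplus, Copp, Cmult; simpl; ring.
Qed.

(** From [w + z = 2 w - (w - z)]. With [Cmod w = 1] it bounds the denominator of the Cayley
    transform from below near [w], and it brings the factor between chord and [p] close to [2]. *)
Lemma Cmod_plus_ge (w z : C) : 2 * Cmod w - Cmod (z - w) <= Cmod (w + z).
Proof.
  assert (H := Cmod_triangle_rev (RtoC 2 * w) (w - z)).
  replace (RtoC 2 * w - (w - z))%C with (w + z)%C in H
    by (replace (RtoC 2) with (1 + 1)%C by (rewrite <- RtoC_plus; f_equal; ring); ring).
  rewrite Cmod_mult, Cmod_R, Rabs_pos_eq, (Cmod_minus_sym w) in H by lra; exact H.
Qed.

(** * The chord estimate on a short arc *)

Section BoundaryArc.

Variables (f : C -> C) (c d : R).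
Hypothesis f_analytic : analytic_on_disc f.
Hypothesis f_lt1 : forall z, unit_disc z -> Cmod (f z) < 1.
Hypothesis f_0 : f (RtoC 0) = RtoC 0.
Hypothesis cd : c < d.
Hypothesis f_limit : forall t, c <= t <= d -> forall e, 0 < e -> exists del, 0 < del /\
  forall y, Cmod y < 1 -> Cmod (y - expi t) < del -> Cmod (f y - f (expi t)) < e.
Hypothesis f_arc1 : forall t, c <= t <= d -> Cmod (f (expi t)) = 1.
Hypothesis f_close : forall t, c <= t <= d -> Cmod (f (expi t) - f (expi c)) <= 1 / 2.

Let a := Cmod (C_derive f (RtoC 0)).
Let u := f (expi c).
Let v := f (expi d).

Let p (z : C) : C := ((1 + - (Cconj u * f z)) * / (1 + Cconj u * f z))%C.

(** Uniformity in [t] by compactness of [[c, d]]. Closeness to some value of [f] on the arc is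
    enough, because [f_arc1] and [f_close] hold at all its points. *)
Lemma boundary_uniform (e : R) : 0 < e -> exists r, 0 < r < 1 /\
  forall b t, r < b < 1 -> c <= t <= d ->
    exists t', c <= t' <= d /\ Cmod (f (polar (RtoC 0) b t) - f (expi t')) < e.
Proof.
  intros He.
  (* One [del] pays for the change of angle, the other for the distance to the circle. *)
  assert (Hdel : forall t, exists del : posreal, c <= t <= d -> forall y, Cmod y < 1 ->
    Cmod (y - expi t) < 2 * del -> Cmod (f y - f (expi t)) < e).
  { intros t; destruct (Rle_dec c t) as [H1|H1].
    - destruct (Rle_dec t d) as [H2|H2].
      + destruct (f_limit t (conj H1 H2) e He) as (del & Hdel & Hy).
        exists (mkposreal (del / 2) ltac:(lra)); simpl; intros _ y Hy1 Hyt.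
        apply Hy; [exact Hy1 | lra].
      + exists (mkposreal 1 Rlt_0_1); lra.
    - exists (mkposreal 1 Rlt_0_1); lra. }
  set (del := fun t => proj1_sig (constructive_indefinite_description _ (Hdel t))).
  destruct (compactness_value_1d c d del) as [d0 Hd0].
  exists (Rmax (1 / 2) (1 - d0)); split.
  { generalize (cond_pos d0) (Rmax_l (1 / 2) (1 - d0)); intros Hp Hm.
    split; [lra | apply Rmax_lub_lt; lra]. }
  intros b t Hb Ht.
  destruct (NNPP _ (Hd0 t Ht)) as (t' & Ht' & Htt & Hdd).
  exists t'; split; [exact Ht'|].
  assert (Hb1 := Rmax_l (1 / 2) (1 - d0)); assert (Hb2 := Rmax_r (1 / 2) (1 - d0)).
  unfold del in Htt, Hdd.
  destruct (constructive_indefinite_description _ (Hdel t')) as [del' Hdel']; simpl in *.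
  apply Hdel'; [exact Ht' | rewrite Cmod_polar_0; lra |].
  eapply Rle_lt_trans; [apply Cmod_polar_0_expi_le; lra | lra].
Qed.

Lemma Cmod_u : Cmod u = 1.
Proof. apply f_arc1; lra. Qed.

Lemma Cmod_conj_u_mult (z : C) : Cmod (Cconj u * z) = Cmod z.
Proof. rewrite Cmod_mult, Cmod_conj, Cmod_u; ring. Qed.

Lemma conj_u_u : (Cconj u * u)%C = RtoC 1.
Proof.
  rewrite Cmult_comm, <- Cmod2_conj, Cmod_u; f_equal; ring.
Qed.

Lemma one_plus_conj_u (z : C) : (1 + Cconj u * z)%C = (Cconj u * (u + z))%C.
Proof. rewrite Cmult_plus_distr_l, conj_u_u; reflexivity. Qed.

Lemma cayley_denominator (z : C) : Cmod z < 1 -> (1 + Cconj u * f z)%C <> RtoC 0.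
Proof.
  intros Hz; apply Cmod_pos_neq; specialize (f_lt1 z Hz).
  generalize (Cmod_triangle_rev 1 (- (Cconj u * f z))).
  replace (1 - - (Cconj u * f z))%C with (1 + Cconj u * f z)%C by ring.
  rewrite Cmod_opp, Cmod_conj_u_mult, Cmod_1; lra.
Qed.

Lemma p_differentiable (z : C) : Cmod z < 1 -> differentiable_C p z.
Proof.
  intros Hz.
  assert (Hm : differentiable_C (fun y => Cconj u * f y)%C z)
    by (apply differentiable_C_mult; [apply differentiable_C_const | now apply f_analytic]).
  unfold p; apply differentiable_C_mult; [|apply differentiable_C_inv].
  - apply (differentiable_C_ext_loc (fun y => 1 + - (1) * (Cconj u * f y))%C _ z 1); [lra| |].
    + intros y _; ring.
    + apply differentiable_C_plus; [apply differentiable_C_const|].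
      apply differentiable_C_mult; [apply differentiable_C_const | exact Hm].
  - apply differentiable_C_plus; [apply differentiable_C_const | exact Hm].
  - now apply cayley_denominator.
Qed.

Lemma Re_p (z : C) : Cmod z < 1 ->
  Re (p z) * Cmod (u + f z) ^ 2 = 1 - Cmod (f z) ^ 2.
Proof.
  intros Hz; rewrite <- (Cmod_conj_u_mult (f z)), <- (Cmod_conj_u_mult (u + f z)).
  rewrite <- one_plus_conj_u.
  apply Re_cayley; now apply cayley_denominator.
Qed.

(** A polynomial consequence of [1 - b(r)^2 <= 4 Re p], using [(1 - b) (1 + a r) = 1 - r^2] and
    [b >= r^2]. Nothing is lost to first order at [r = 1], since [(1 + r) (1 + r^2)] tends to
    [4]. *)
Lemma Re_p_ge (z : C) : Cmod z < 1 ->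
  (1 - Cmod z) * ((1 + Cmod z) * (1 + Cmod z ^ 2)) <= 4 * (1 + a) * Re (p z).
Proof.
  intros Hz.
  assert (Hgr := analytic_growth f f_analytic f_lt1 f_0 z Hz); fold a in Hgr.
  assert (Hre := Re_p z Hz).
  assert (Hfz := f_lt1 z Hz); assert (Hf0 := Cmod_ge_0 (f z)); assert (Hr0 := Cmod_ge_0 z).
  assert (Ha : 0 <= a) by apply Cmod_ge_0.
  assert (Htri := Cmod_triangle u (f z)); rewrite Cmod_u in Htri.
  assert (Hs0 := Cmod_ge_0 (u + f z)).
  revert Hgr Hre Hfz Hf0 Hr0 Hz Htri Hs0.
  generalize (Re (p z)) (Cmod (u + f z)) (Cmod (f z)) (Cmod z); intros P s F r.
  intros Hgr Hre HF1 HF0 Hr0 Hr1 Hs Hs0.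
  assert (HP : 1 - F ^ 2 <= 4 * P).
  { assert (0 <= P).
    { apply Rnot_lt_le; intros HP; assert (0 < 1 - F ^ 2) by nra.
      assert (0 <= s ^ 2) by nra. nra. }
    assert (s ^ 2 <= 4) by nra. nra. }
  assert (Hd : 0 < 1 + a * r) by nra.
  set (b := r * (r + a) / (1 + a * r)).
  assert (Eb : b * (1 + a * r) = r * (r + a)) by (unfold b; field; lra).
  assert (HFb : F <= b).
  { apply Rmult_le_reg_r with (1 + a * r); [exact Hd|]; lra. }
  assert (Hb2 : r ^ 2 <= b).
  { apply Rmult_le_reg_r with (1 + a * r); [exact Hd|]; rewrite Eb.
    assert (0 <= r * a * (1 - r * r)) by (apply Rmult_le_pos; nra). nra. }
  assert (Hb1 : (1 - r) * (1 + r) <= (1 - b) * (1 + a)).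
  { assert (E : (1 - b) * (1 + a * r) = (1 - r) * (1 + r)) by lra.
    assert (0 <= 1 - b) by (apply Rmult_le_reg_r with (1 + a * r); [exact Hd|]; nra).
    assert (0 <= (1 - b) * (a * (1 - r))) by (apply Rmult_le_pos; [lra | apply Rmult_le_pos; lra]).
    nra. }
  assert (H1 : 1 - b ^ 2 <= 4 * P) by nra.
  assert (H2 : (1 - r) * (1 + r) * (1 + r ^ 2) <= (1 - b) * (1 + a) * (1 + b)).
  { apply Rmult_le_compat; nra. }
  assert (H3 : (1 - b ^ 2) * (1 + a) <= 4 * P * (1 + a)) by (apply Rmult_le_compat_r; lra).
  lra.
Qed.

Lemma Re_p_small (e : R) : 0 < e -> exists r, 0 < r < 1 /\
  forall b t, r < b < 1 -> c <= t <= d -> Re (p (polar (RtoC 0) b t)) <= e.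
Proof.
  intros He.
  (* The bound [1 / 2], together with [f_close], gives [Cmod (u + f z) >= 1]; the bound [e / 2]
     gives [1 - Cmod (f z) ^ 2 <= e]. *)
  set (e' := Rmin (1 / 2) (e / 2)).
  assert (E0 : 0 < e') by (apply Rmin_pos; lra).
  assert (E1 : e' <= 1 / 2) by apply Rmin_l.
  assert (E2 : e' <= e / 2) by apply Rmin_r.
  destruct (boundary_uniform e' E0) as (r & Hr & H).
  exists r; split; [exact Hr|]; intros b t Hb Ht.
  destruct (H b t Hb Ht) as (t' & Ht' & Hc).
  set (z := polar (RtoC 0) b t) in *.
  assert (Hz : Cmod z < 1) by (unfold z; rewrite Cmod_polar_0; lra).
  assert (Hre := Re_p z Hz); assert (Hfz := f_lt1 z Hz).
  assert (H1 := Cmod_triangle_rev (f (expi t')) (f z)).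
  rewrite f_arc1, Cmod_minus_sym in H1 by exact Ht'.
  assert (H2 := f_close t' Ht'); fold u in H2.
  assert (H3 := Cmod_triangle (f z - f (expi t')) (f (expi t') - u)).
  replace (f z - f (expi t') + (f (expi t') - u))%C with (f z - u)%C in H3 by ring.
  assert (H4 := Cmod_plus_ge u (f z)); rewrite Cmod_u in H4.
  assert (H5 : 1 <= Cmod (u + f z)) by lra.
  assert (Hp : 0 <= Cmod (f z)) by apply Cmod_ge_0.
  assert (H6 : Re (p z) * Cmod (u + f z) ^ 2 <= e) by (rewrite Hre; nra).
  assert (H7 : 1 <= Cmod (u + f z) ^ 2) by nra.
  destruct (Rle_lt_dec (Re (p z)) 0); [lra|].
  assert (0 <= Re (p z) * (Cmod (u + f z) ^ 2 - 1)) by (apply Rmult_le_pos; lra); lra.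
Qed.

Lemma p_radial_limit (t e : R) : c <= t <= d -> 0 < e -> exists r, 0 < r < 1 /\
  forall b, r < b < 1 -> Cmod (p (polar (RtoC 0) b t)
    - (1 + - (Cconj u * f (expi t))) * / (1 + Cconj u * f (expi t))) < e.
Proof.
  intros Ht He.
  set (w := f (expi t)).
  assert (Hw : (1 + Cconj u * w)%C <> RtoC 0).
  { rewrite one_plus_conj_u; apply Cmod_pos_neq; rewrite Cmod_conj_u_mult.
    assert (H := Cmod_plus_ge u w); rewrite Cmod_u in H.
    generalize (f_close t Ht); fold u w; lra. }
  assert (Hk : continuous_C (fun y => (1 + - (Cconj u * y)) * / (1 + Cconj u * y))%C w).
  { apply continuous_C_mult; [|apply continuous_C_inv; [|exact Hw]].
    - apply (continuous_C_ext_loc (fun y => 1 + - Cconj u * y)%C _ w 1); [lra| |].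
      + intros y _; ring.
      + apply continuous_C_plus; [apply continuous_C_const|].
        apply continuous_C_mult; [apply continuous_C_const | apply continuous_C_id].
    - apply continuous_C_plus; [apply continuous_C_const|].
      apply continuous_C_mult; [apply continuous_C_const | apply continuous_C_id]. }
  destruct (proj1 (continuous_C_eps _ w) Hk e He) as (del & Hdel & Hy).
  destruct (f_limit t Ht del Hdel) as (del' & Hdel' & Hy').
  exists (Rmax (1 / 2) (1 - del')); split.
  { generalize (Rmax_l (1 / 2) (1 - del')); intros Hm.
    split; [lra | apply Rmax_lub_lt; lra]. }
  intros b Hb.
  assert (Hb1 := Rmax_l (1 / 2) (1 - del')); assert (Hb2 := Rmax_r (1 / 2) (1 - del')).
  apply (Hy (f (polar (RtoC 0) b t))), Hy'; [rewrite Cmod_polar_0; lra|].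
  eapply Rle_lt_trans; [apply Cmod_polar_0_expi_le; lra|].
  rewrite Rminus_diag, Rabs_R0; lra.
Qed.

(** Closedness of the form on the sector: the inner arc contributes at least [(d - c) * m], the
    outer one at most [(d - c) * e], and the radii, shorter than [1 - r0], at most [x / r0] per unit
    length. As [r1] is absent from the conclusion, it can tend to [1] for fixed [r0]. *)
Lemma arc_length_le_chord (x r0 r1 : R) :
  0 < r0 < r1 -> r1 < 1 ->
  (forall r, r0 <= r <= r1 ->
    Rabs (Im (p (polar (RtoC 0) r d)) - Im (p (polar (RtoC 0) r c))) <= x) ->
  forall e, (forall t, c <= t <= d -> Re (p (polar (RtoC 0) r1 t)) <= e) ->
  (d - c) * ((1 - r0) * ((1 + r0) * (1 + r0 ^ 2))) * r0
    <= 4 * (1 + a) * ((1 - r0) * x + (d - c) * e * r0).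
Proof.
  intros Hr0 Hr1 Hx e He.
  assert (Ha : 0 <= a) by apply Cmod_ge_0.
  set (m := (1 - r0) * ((1 + r0) * (1 + r0 ^ 2)) / (4 * (1 + a))).
  assert (Hdp : forall r t, r0 <= r <= r1 -> differentiable_C p (polar (RtoC 0) r t)).
  { intros r t Hr; apply p_differentiable; rewrite Cmod_polar_0; lra. }
  assert (E := polar_circulation p (RtoC 0) r0 r1 c d Hr0 cd (fun r t Hr _ => Hdp r t Hr)).
  assert (HL : RInt (fun t => Re (p (polar (RtoC 0) r1 t)) - Re (p (polar (RtoC 0) r0 t))) c d
    <= RInt (fun _ => e - m) c d).
  { apply RInt_le; [lra | | apply ex_RInt_const |].
    - apply (ex_RInt_continuous (V := R_CompleteNormedModule)); intros t _.
      apply (continuous_minus (V := R_NormedModule) (fun t => Re (p (polar (RtoC 0) r1 t)))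
        (fun t => Re (p (polar (RtoC 0) r0 t))));
        apply differentiable_C_continuous_Re_polar, Hdp; lra.
    - intros t Ht.
      assert (H1 := He t ltac:(lra)).
      assert (H2 := Re_p_ge (polar (RtoC 0) r0 t)); rewrite Cmod_polar_0 in H2 by lra.
      specialize (H2 ltac:(lra)).
      assert (H3 : m <= Re (p (polar (RtoC 0) r0 t))).
      { unfold m; apply Rmult_le_reg_r with (4 * (1 + a)); [lra|].
        unfold Rdiv; rewrite Rmult_assoc, Rinv_l by lra; lra. }
      lra. }
  rewrite RInt_const in HL; change (scal (d - c) (e - m)) with ((d - c) * (e - m)) in HL.
  assert (Hx0 : 0 <= x) by (eapply Rle_trans; [apply Rabs_pos | apply (Hx r0); lra]).
  assert (HR : Rabs (RInt (fun r => (Im (p (polar (RtoC 0) r d)) - Im (p (polar (RtoC 0) r c))) / r)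
    r0 r1) <= (r1 - r0) * (x / r0)).
  { apply abs_RInt_le_const; [lra | |].
    - apply (ex_RInt_continuous (V := R_CompleteNormedModule)); intros r.
      rewrite Rmin_left, Rmax_right by lra; intros Hr.
      assert (Him : forall t, continuous (fun r => Im (p (polar (RtoC 0) r t))) r).
      { intros t; destruct (differentiable_C_re_im p _ (Hdp r t Hr)) as (y & z & _ & HIm).
        exact (continuity_2d_pt_1 (fun r t => Im (p (polar (RtoC 0) r t))) r t
          (differentiable_pt_lim_continuity_2d _ _ _ _ _
            (differentiable_pt_lim_polar (fun x y => Im (p (x, y))) (RtoC 0) r t _ _ HIm))). }
      apply (continuous_mult (K := R_AbsRing)
        (fun r => Im (p (polar (RtoC 0) r d)) - Im (p (polar (RtoC 0) r c))) Rinv).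
      + now apply (continuous_minus (V := R_NormedModule)).
      + apply continuous_Rinv; lra.
    - intros r Hr; unfold Rdiv; rewrite Rabs_mult, Rabs_inv, (Rabs_pos_eq r) by lra.
      apply Rmult_le_compat; [apply Rabs_pos | apply Rlt_le, Rinv_0_lt_compat; lra
        | apply Hx; lra | apply Rinv_le_contravar; lra]. }
  rewrite <- E in HR; apply Rabs_le_between in HR.
  assert (Hxr : 0 <= x / r0) by (apply Rdiv_le_0_compat; lra).
  assert (H1 : (r1 - r0) * (x / r0) <= (1 - r0) * (x / r0)) by (apply Rmult_le_compat_r; lra).
  assert (H2 : (d - c) * (m - e) <= (1 - r0) * (x / r0)) by lra.
  assert (H3 : (d - c) * (m - e) * r0 <= (1 - r0) * x).
  { apply (Rmult_le_compat_r r0) in H2; [|lra].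
    replace ((1 - r0) * (x / r0) * r0) with ((1 - r0) * x) in H2 by (field; lra); exact H2. }
  assert (Em : (1 - r0) * ((1 + r0) * (1 + r0 ^ 2)) = m * (4 * (1 + a)))
    by (unfold m; field; lra).
  rewrite Em.
  apply (Rmult_le_compat_l (4 * (1 + a))) in H3; lra.
Qed.

Lemma boundary_chord : (d - c) * Cmod (u + v) <= (1 + a) * Cmod (v - u).
Proof.
  assert (Ha : 0 <= a) by apply Cmod_ge_0.
  assert (Huv : 0 < Cmod (u + v)).
  { assert (H := Cmod_plus_ge u v); rewrite Cmod_u in H.
    generalize (f_close d ltac:(lra)); fold u v; lra. }
  set (x := Cmod (v - u) / Cmod (u + v)).
  assert (Hx : 0 <= x) by (apply Rdiv_le_0_compat; [apply Cmod_ge_0 | exact Huv]).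
  assert (Main : d - c <= (1 + a) * x).
  { apply le_epsilon; intros e0 He0.
    (* The final error is at most [(1 + a) * e + e / 4], which [e0] absorbs. *)
    set (e := e0 / (2 * (1 + a) + 1)).
    assert (He : 0 < e) by (apply Rdiv_lt_0_compat; lra).
    assert (Ee : e * (2 * (1 + a) + 1) = e0) by (unfold e; field; lra).
    destruct (p_radial_limit c (e / 2)) as (rc & Hrc & Lc); [lra | lra |].
    destruct (p_radial_limit d (e / 2)) as (rd & Hrd & Ld); [lra | lra |].
    (* The [10] is the derivative at [1] of [r + r^2 + r^3 + r^4 = (1 + r) (1 + r^2) r], which is
       bounded below in [H2] by its tangent [4 - 10 (1 - r)]. *)
    set (r0 := Rmax (1 - e / (10 * (d - c))) ((1 + Rmax rc rd) / 2)).
    assert (M1 := Rmax_l rc rd); assert (M2 := Rmax_r rc rd).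
    assert (M3 : Rmax rc rd < 1) by (apply Rmax_lub_lt; lra).
    assert (M4 : 1 - e / (10 * (d - c)) <= r0) by apply Rmax_l.
    assert (M5 : (1 + Rmax rc rd) / 2 <= r0) by apply Rmax_r.
    assert (M6 : 0 < e / (10 * (d - c))) by (apply Rdiv_lt_0_compat; lra).
    assert (M7 : r0 < 1) by (apply Rmax_lub_lt; lra).
    assert (M8 : 10 * (d - c) * (1 - r0) <= e).
    { replace e with (10 * (d - c) * (e / (10 * (d - c)))) by (field; lra).
      apply Rmult_le_compat_l; lra. }
    assert (Him : forall r, r0 <= r < 1 ->
      Rabs (Im (p (polar (RtoC 0) r d)) - Im (p (polar (RtoC 0) r c))) <= x + e).
    { intros r Hr.
      assert (L1 := Lc r ltac:(lra)); assert (L2 := Ld r ltac:(lra)).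
      fold u in L1; fold v in L2; rewrite conj_u_u in L1.
      replace ((1 + - (1)) * / (1 + 1))%C with (RtoC 0) in L1 by ring.
      set (zc := p (polar (RtoC 0) r c)) in *; set (zd := p (polar (RtoC 0) r d)) in *.
      set (q := ((1 + - (Cconj u * v)) * / (1 + Cconj u * v))%C) in *.
      assert (Eq : Cmod q = x).
      { unfold q; rewrite one_plus_conj_u, Cmod_mult, Cmod_inv.
        - rewrite Cmod_conj_u_mult, <- conj_u_u.
          replace (Cconj u * u + - (Cconj u * v))%C with (Cconj u * (u - v))%C by ring.
          rewrite Cmod_conj_u_mult, Cmod_minus_sym; reflexivity.
        - apply Cmod_pos_neq; rewrite Cmod_conj_u_mult; exact Huv. }
      change (Im zd - Im zc) with (Im (zd - zc)).
      eapply Rle_trans; [eapply Rle_trans; [apply Rmax_r | apply Rmax_Cmod]|].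
      replace (zd - zc)%C with ((zd - q) + q + - (zc - 0))%C by ring.
      assert (T1 := Cmod_triangle (zd - q + q) (- (zc - 0))).
      assert (T2 := Cmod_triangle (zd - q) q).
      rewrite Cmod_opp in T1; lra. }
    (* Here [r0] is fixed and the outer radius is sent to [1]; only then can the factor [1 - r0] be
       cancelled. *)
    assert (Hall : forall e', 0 < e' ->
      (d - c) * ((1 - r0) * ((1 + r0) * (1 + r0 ^ 2))) * r0
        <= 4 * (1 + a) * ((1 - r0) * (x + e)) + e').
    { intros e' He'.
      assert (Hq : 0 < 4 * (1 + a) * (d - c)) by (apply Rmult_lt_0_compat; lra).
      destruct (Re_p_small (e' / (4 * (1 + a) * (d - c)))) as (r1 & Hr1 & Hsm).
      { now apply Rdiv_lt_0_compat. }
      set (b := (1 + Rmax r0 r1) / 2).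
      assert (B1 := Rmax_l r0 r1); assert (B2 := Rmax_r r0 r1).
      assert (B3 : Rmax r0 r1 < 1) by (apply Rmax_lub_lt; lra).
      assert (H := arc_length_le_chord (x + e) r0 b ltac:(unfold b; lra) ltac:(unfold b; lra)
        (fun r Hr => Him r ltac:(unfold b in *; lra)) _
        (fun t Ht => Hsm b t ltac:(unfold b; lra) Ht)).
      replace (4 * (1 + a) * ((1 - r0) * (x + e)
        + (d - c) * (e' / (4 * (1 + a) * (d - c))) * r0))
        with (4 * (1 + a) * ((1 - r0) * (x + e)) + e' * r0) in H by (field; lra).
      assert (e' * r0 <= e' * 1) by (apply Rmult_le_compat_l; lra).
      lra. }
    apply le_epsilon in Hall.
    assert (H1 : (d - c) * ((1 + r0) * (1 + r0 ^ 2) * r0) <= 4 * (1 + a) * (x + e)).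
    { apply Rmult_le_reg_l with (1 - r0); lra. }
    assert (H2 : 4 - 10 * (1 - r0) <= (1 + r0) * (1 + r0 ^ 2) * r0).
    { assert (0 <= (1 - r0) ^ 2 * (4 - (1 - r0))) by (apply Rmult_le_pos; nra). nra. }
    assert (H3 : (d - c) * (4 - 10 * (1 - r0)) <= 4 * (1 + a) * (x + e)).
    { eapply Rle_trans; [|exact H1]; apply Rmult_le_compat_l; lra. }
    assert (0 <= (1 + a) * e) by nra.
    lra. }
  replace ((1 + a) * Cmod (v - u)) with ((1 + a) * x * Cmod (u + v))
    by (unfold x; field; lra).
  apply Rmult_le_compat_r; lra.
Qed.

End BoundaryArc.

(** * From local chord estimates to lengths *)

(** The admissible step depends on [t], so the polygon is grown from [t0]: the supremum of the
    points it can reach must be [t1], since the estimate around the supremum allows a step past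
    it. *)
Lemma polygon_of_local_chords (g : R -> C) (k t0 t1 : R) :
  t0 <= t1 ->
  (forall t, t0 <= t <= t1 -> exists e, 0 < e /\ forall c d, t0 <= c -> c < d -> d <= t1 ->
    Rabs (c - t) < e -> Rabs (d - t) < e -> k * (d - c) <= Cmod (g d - g c)) ->
  exists n (t : nat -> R),
    (forall i, t0 <= t i <= t1) /\ (forall i, (i <= n)%nat -> t i <= t (S i)) /\
    k * (t1 - t0) <= sum_n (fun i => Cmod (g (t (S i)) - g (t i))) n.
Proof.
  intros Ht Hloc.
  set (reach := fun x => t0 <= x <= t1 /\ exists n (t : nat -> R),
    (forall i, t0 <= t i <= x) /\ (forall i, (i <= n)%nat -> t i <= t (S i)) /\
    t (S n) = x /\
    k * (x - t0) <= sum_n (fun i => Cmod (g (t (S i)) - g (t i))) n).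
  assert (Hext : forall x y, reach x -> x < y <= t1 ->
    k * (y - x) <= Cmod (g y - g x) -> reach y).
  { intros x y (Hx & n & t & Hti & Hmon & Hlast & Hsum) Hy Hk.
    split; [lra|].
    exists (S n), (fun i => if le_dec i (S n) then t i else y); split; [|split; [|split]].
    - intros i; destruct (le_dec i (S n)); [specialize (Hti i); lra | lra].
    - intros i Hi; destruct (le_dec i (S n)) as [H1|H1]; [|lia].
      destruct (le_dec (S i) (S n)) as [H2|H2]; [apply Hmon; lia|].
      specialize (Hti i); lra.
    - destruct (le_dec (S (S n)) (S n)); [lia | reflexivity].
    - rewrite sum_Sn; unfold plus; simpl.
      rewrite (sum_n_ext_loc _ (fun i => Cmod (g (t (S i)) - g (t i)))).
      + destruct (le_dec (S (S n)) (S n)); [lia|].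
        destruct (le_dec (S n) (S n)); [|lia].
        rewrite Hlast; lra.
      + intros i Hi; destruct (le_dec (S i) (S n)); [|lia].
        destruct (le_dec i (S n)); [reflexivity | lia]. }
  assert (Hstart : reach t0).
  { split; [lra|]; exists 0%nat, (fun _ => t0); repeat split; try (intros; lra).
    rewrite sum_O, Rminus_diag, Rmult_0_r; apply Cmod_ge_0. }
  destruct (completeness reach) as [m [Hub Hleast]].
  { exists t1; intros x [Hx _]; lra. }
  { now exists t0. }
  assert (Hm : t0 <= m <= t1).
  { split; [now apply Hub|]; apply Hleast; intros x [Hx _]; lra. }
  destruct (Hloc m Hm) as (e & He & Hch).
  assert (Hnear : exists x, reach x /\ m - e < x).
  { apply NNPP; intros Hn.
    assert (m <= m - e); [|lra].
    apply Hleast; intros x Hx; apply Rnot_lt_le; intros Hlt; apply Hn; now exists x. }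
  destruct Hnear as (x & Hx & Hxe).
  assert (Hxm := Hub x Hx); assert (Hxt := proj1 Hx).
  (* A target beyond the supremum unless it is [t1]; reaching it therefore forces [y = t1]. *)
  set (y := Rmin t1 (m + e / 2)).
  assert (Y1 : y <= t1) by apply Rmin_l.
  assert (Y2 : y <= m + e / 2) by apply Rmin_r.
  assert (Hr1 : reach t1).
  { destruct (Rlt_le_dec x y) as [Hxy|Hxy].
    - assert (Hy : reach y).
      { apply (Hext x); [exact Hx | lra |].
        apply Hch; try lra; apply Rabs_lt_between; lra. }
      assert (Hym := Hub y Hy).
      unfold y, Rmin in *; destruct (Rle_dec t1 (m + e / 2)); [exact Hy | lra].
    - replace t1 with x; [exact Hx|].
      unfold y, Rmin in *; destruct (Rle_dec t1 (m + e / 2)); lra. }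
  destruct Hr1 as (_ & n & t & Hti & Hmon & _ & Hsum).
  now exists n, t.
Qed.

Lemma sum_n_telescope_le (F : nat -> R) (t : nat -> R) (n : nat) :
  (forall i, (i <= n)%nat -> F i <= t (S i) - t i) -> sum_n F n <= t (S n) - t 0%nat.
Proof.
  induction n as [|n IH]; intros H.
  - rewrite sum_O; now apply H.
  - rewrite sum_Sn; unfold plus; simpl.
    generalize (IH ltac:(intros; apply H; lia)) (H (S n) ltac:(lia)); lra.
Qed.

(** Excludes [m_infty] as a least upper bound of inscribed lengths. *)
Lemma inscribed_length_0 (I : R -> Prop) (g : R -> C) (t : R) :
  I t -> inscribed_length I g 0.
Proof.
  intros Ht; exists 0%nat, (fun _ => t); repeat split; [auto | intros; lra |].
  rewrite sum_O; replace (g t - g t)%C with (RtoC 0) by ring; now rewrite Cmod_0.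
Qed.

Theorem corollary2 (f : C -> C) (I : R -> Prop)
  (f_analytic : analytic_on_disc f)
  (f_lt1 : forall z : C, unit_disc z -> Cmod (f z) < 1)
  (f_0 : f (RtoC 0) = RtoC 0)
  (I_arc : arc_interval I)
  (f_cont : continuous_on (fun z : C => unit_disc z \/ unit_arc I z) f)
  (f_arc : forall z : C, unit_arc I z -> Cmod (f z) = 1) :
  Rbar_le
    (Rbar_mult (Finite (2 / (1 + Cmod (C_derive f (RtoC 0))))) (curve_length I expi))
    (curve_length I (fun t : R => f (expi t))).
Proof.
  destruct I_arc as ((t_0 & _ & Ht_0 & _) & Hconv & _).
  set (a := Cmod (C_derive f (RtoC 0))).
  assert (Ha : 0 <= a) by apply Cmod_ge_0.
  set (K := 2 / (1 + a)).
  assert (HK : 0 < K) by (apply Rdiv_lt_0_compat; lra).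
  assert (Hcont : forall t, I t -> forall e, 0 < e -> exists d, 0 < d /\
    forall y, unit_disc y \/ unit_arc I y -> Cmod (y - expi t) < d ->
      Cmod (f y - f (expi t)) < e).
  { intros t Ht e He.
    assert (Harc : unit_arc I (expi t)) by now exists t.
    assert (H := f_cont (expi t) (or_intror Harc) (fun w => Cmod (w - f (expi t)) < e)).
    lapply H; [clear H; intros H|].
    - apply locally_C_eps in H; destruct H as (d & Hd & Hy).
      exists d; split; [exact Hd|]; intros y Hy1 Hy2; now apply Hy.
    - apply locally_C_eps; exists e; split; [exact He | auto]. }
  assert (Hpoly : forall k t0 t1, I t0 -> I t1 -> t0 <= t1 -> k < K ->
    exists L, inscribed_length I (fun t => f (expi t)) L /\ k * (t1 - t0) <= L).
  { intros k t0 t1 Ht0 Ht1 Ht Hk.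
    destruct (polygon_of_local_chords (fun t => f (expi t)) k t0 t1 Ht)
      as (n & t & Hti & Hmon & Hsum).
    - intros t Ht'.
      assert (HIt : I t) by now apply (Hconv t0 t t1).
      (* Since [K * (1 + a) = 2], two values on the circle at distance at most [eta] have a sum of
         modulus at least [2 - eta >= k * (1 + a)]. The bound [1 / 2] is what [boundary_chord] asks
         for. *)
      set (eta := Rmin (1 / 2) ((K - k) * (1 + a))).
      assert (E1 : 0 < eta) by (apply Rmin_pos; [lra | apply Rmult_lt_0_compat; lra]).
      assert (E2 : eta <= 1 / 2) by apply Rmin_l.
      assert (E3 : eta <= (K - k) * (1 + a)) by apply Rmin_r.
      destruct (Hcont t HIt (eta / 2)) as (e & He & Hy); [lra|].
      exists e; split; [exact He|]; intros c d Hc Hcd Hd Hce Hde.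
      assert (Hnear : forall s, c <= s <= d -> I s /\ Cmod (f (expi s) - f (expi t)) < eta / 2).
      { intros s Hs; assert (HIs : I s) by (apply (Hconv t0 s t1); auto; lra).
        split; [exact HIs|].
        apply Hy; [right; now exists s|].
        eapply Rle_lt_trans; [apply Cmod_expi_minus_le|].
        apply Rabs_lt_between in Hce; apply Rabs_lt_between in Hde.
        apply Rabs_lt_between; lra. }
      assert (Hclose : forall s, c <= s <= d -> Cmod (f (expi s) - f (expi c)) <= eta).
      { intros s Hs.
        replace (f (expi s) - f (expi c))%C
          with ((f (expi s) - f (expi t)) + - (f (expi c) - f (expi t)))%C by ring.
        eapply Rle_trans; [apply Cmod_triangle|]; rewrite Cmod_opp.
        generalize (proj2 (Hnear s Hs)) (proj2 (Hnear c ltac:(lra))); lra. }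
      assert (H := boundary_chord f c d f_analytic f_lt1 f_0 Hcd).
      lapply H; [clear H; intros H|].
      2: { intros s Hs e' He'; destruct (Hcont s (proj1 (Hnear s Hs)) e' He') as (d' & Hd' & H').
           exists d'; split; [exact Hd'|]; intros y Hy1; apply H'; now left. }
      lapply H; [clear H; intros H|].
      2: { intros s Hs; apply f_arc; exists s; split; [apply Hnear, Hs | reflexivity]. }
      lapply H; [clear H; intros H|].
      2: { intros s Hs; specialize (Hclose s Hs); lra. }
      fold a in H.
      assert (Hcl := Hclose d ltac:(lra)).
      assert (Hu : Cmod (f (expi c)) = 1).
      { apply f_arc; exists c; split; [apply Hnear; lra | reflexivity]. }
      assert (H4 := Cmod_plus_ge (f (expi c)) (f (expi d))); rewrite Hu in H4.
      assert (EK : K * (1 + a) = 2) by (unfold K; field; lra).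
      assert (H5 : k * (1 + a) <= Cmod (f (expi c) + f (expi d))) by lra.
      apply Rmult_le_reg_l with (1 + a); [lra|].
      eapply Rle_trans; [|exact H].
      replace ((1 + a) * (k * (d - c))) with ((d - c) * (k * (1 + a))) by ring.
      apply Rmult_le_compat_l; lra.
    - eexists; split; [|exact Hsum].
      exists n, t; repeat split; [|exact Hmon].
      intros i _; apply (Hconv t0 (t i) t1); auto. }
  unfold curve_length.
  destruct (Lub_Rbar_correct (inscribed_length I expi)) as [Hub1 Hleast1].
  destruct (Lub_Rbar_correct (inscribed_length I (fun t => f (expi t)))) as [Hub2 _].
  assert (H01 := Hub1 0 (inscribed_length_0 I expi t_0 Ht_0)).
  assert (H02 := Hub2 0 (inscribed_length_0 I (fun t => f (expi t)) t_0 Ht_0)).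
  (* The claim is trivial when the image has infinite length. *)
  destruct (Lub_Rbar (inscribed_length I (fun t => f (expi t)))) as [s| |];
    [|now destruct (Rbar_mult _ _)|contradiction].
  (* The length of the arc need not be computed: a polygon inscribed in the circle is no longer than
     its parameter interval, to which [Hpoly] applies. *)
  assert (Hbound : Rbar_le (Lub_Rbar (inscribed_length I expi)) (Finite (s / K))).
  { apply Hleast1; intros L (n & t & HIt & Hmon & ->).
    apply Rle_trans with (t (S n) - t 0%nat).
    - apply sum_n_telescope_le; intros i Hi.
      eapply Rle_trans; [apply Cmod_expi_minus_le|].
      rewrite Rabs_pos_eq; [lra | specialize (Hmon i Hi); lra].
    - assert (Hle : t 0%nat <= t (S n)).
      { assert (H : forall j, (j <= S n)%nat -> t 0%nat <= t j).
        { induction j as [|j IH]; intros Hj; [lra|].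
          generalize (IH ltac:(lia)) (Hmon j ltac:(lia)); lra. }
        now apply H. }
      apply Rmult_le_reg_l with K; [exact HK|].
      replace (K * (s / K)) with s by (field; lra).
      apply le_epsilon; intros e He.
      set (l := t (S n) - t 0%nat) in *.
      assert (Hl : 0 <= l) by (unfold l; lra).
      (* The loss over the whole interval is [e / (l + 1) * l <= e]; the [1] covers [l = 0]. *)
      destruct (Hpoly (K - e / (l + 1)) (t 0%nat) (t (S n))) as (L & HL & Hge).
      + apply HIt; lia.
      + apply HIt; lia.
      + exact Hle.
      + assert (0 < e / (l + 1)) by (apply Rdiv_lt_0_compat; lra); lra.
      + fold l in Hge; specialize (Hub2 L HL); simpl in Hub2.
        assert (e / (l + 1) * l <= e).
        { assert (Hq : 0 < e / (l + 1)) by (apply Rdiv_lt_0_compat; lra).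
          replace e with (e / (l + 1) * (l + 1)) at 2 by (field; lra).
          apply Rmult_le_compat_l; lra. }
        lra. }
  destruct (Lub_Rbar (inscribed_length I expi)) as [l| |];
    [|contradiction|contradiction].
  simpl in *.
  apply Rmult_le_reg_r with (/ K); [now apply Rinv_0_lt_compat|].
  replace (K * l * / K) with l by (field; lra); exact Hbound.
Qed.
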